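(* Let $A$ be a linear operator on a $2$-dimensional complex Hilbert space, and let $*$ be any of the models BCK, pCK, Ph. The conformal range $\mathrm{DW}^{\mathbb R}_*(A)$ is as follows. (i) If $A$ is normal and has a double non-real eigenvalue $\lambda$, or two conjugate non-real eigenvalues $\lambda,\bar\lambda$, then $\mathrm{DW}^{\mathbb R}_*(A)$ consists only of the ordinary $h$-point $\iota^{[2]}_*(\lambda)$. (ii) If $A$ is normal and has two non-real eigenvalues $\lambda_1,\lambda_2$ which are neither equal nor conjugate, then $\mathrm{DW}^{\mathbb R}_*(A)$ is the $h$-segment connecting $\iota^{[2]}_*(\lambda_1)$ and $\iota^{[2]}_*(\lambda_2)$. (iii) If $A$ is normal and has two different real eigenvalues $\lambda_1,\lambda_2$, then $\mathrm{DW}^{\mathbb R}_*(A)$ is the asymptotically closed $h$-line connecting $\iota^{[2]}_*(\lambda_1)$ and $\iota^{[2]}_*(\lambda_2)$. (iv) If $A$ is normal and has a non-real eigenvalue $\lambda_1$ and a real eigenvalue $\lambda_2$, then $\mathrm{DW}^{\mathbb R}_*(A)$ is the asymptotically closed $h$-half-line connecting $\iota^{[2]}_*(\lambda_1)$ and $\iota^{[2]}_*(\lambda_2)$. (v) If $A$ is normal and has a double real eigenvalue $\lambda$, then $\mathrm{DW}^{\mathbb R}_*(A)$ consists only of the asymptotic $h$-point $\iota^{[2]}_*(\lambda)$. (vi) If $A$ is not normal and has a double non-real eigenvalue $\lambda$, or two conjugate non-real eigenvalues $\lambda,\bar\lambda$, then $\mathrm{DW}^{\mathbb R}_*(A)$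 is an $h$-disk, and $\iota^{[2]}_*(\lambda)$ is an interior point of it. (vii) If $A$ is not normal and has two non-real eigenvalues $\lambda_1,\lambda_2$ which are neither equal nor conjugate, then $\mathrm{DW}^{\mathbb R}_*(A)$ is a proper $h$-elliptical disk, and $\iota^{[2]}_*(\lambda_1)$, $\iota^{[2]}_*(\lambda_2)$ are interior points of it. (viii) If $A$ is not normal and has two different real eigenvalues $\lambda_1,\lambda_2$, then $\mathrm{DW}^{\mathbb R}_*(A)$ is an asymptotically closed $h$-distance band around the $h$-line connecting $\iota^{[2]}_*(\lambda_1)$ and $\iota^{[2]}_*(\lambda_2)$. (ix) If $A$ is not normal and has a non-real eigenvalue $\lambda_1$ and a real eigenvalue $\lambda_2$, then $\mathrm{DW}^{\mathbb R}_*(A)$ is an $h$-elliptic parabolic disk with asymptotic point $\iota^{[2]}_*(\lambda_2)$, and $\iota^{[2]}_*(\lambda_1)$ is an interior point of it. (x) If $A$ is not normal and has a double real eigenvalue $\lambda$, then $\mathrm{DW}^{\mathbb R}_*(A)$ is an asymptotically closed $h$-horodisk with asymptotic point $\iota^{[2]}_*(\lambda)$.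
   Context: Conformal range (inner product linear in the first variable): in the BCK model $$\mathrm{DW}^{\mathbb R}_{\mathrm{BCK}}(A)=\left\{\left(\frac{2\,\mathrm{Re}\langle \mathbf y,\mathbf x\rangle}{|\mathbf y|^2+|\mathbf x|^2},\frac{|\mathbf y|^2-|\mathbf x|^2}{|\mathbf y|^2+|\mathbf x|^2}\right): \mathbf y=A\mathbf x,\ \mathbf x\ne0\right\}$$ and in the pCK model $$\mathrm{DW}^{\mathbb R}_{\mathrm{pCK}}(A)=\left\{\left(\frac{\mathrm{Re}\langle \mathbf y,\mathbf x\rangle}{|\mathbf x|^2},\frac{|\mathbf y|^2}{|\mathbf x|^2}\right):\mathbf y=A\mathbf x,\ \mathbf x\neq0\right\}.$$ Models of the asymptotically closed hyperbolic plane. BCK: the closed unit disk $\{(x,z)\in\mathbb R^2: x^2+z^2\le1\}$; interior points are ordinary $h$-points, boundary points are asymptotic $h$-points. pCK: $\{(x,z): x^2\le z\}\cup\{\infty_{\langle0,1\rangle}\}$ (the added point is the ideal point in direction $\langle 0,1\rangle$). Ph: the closed upper half-plane $\{(x,z):z\ge0\}\cup\{\infty\}$. Canonical bijections: $(x,z)_{\mathrm{pCK}}\mapsto\left(\frac{2x}{z+1},\frac{z-1}{z+1}\right)_{\mathrm{BCK}}$, $\infty_{\langle0,1\rangle}\mapsto(0,1)$; and $(x,z)_{\mathrm{BCK}}\mapsto\frac{(x,\sqrt{1-x^2-z^2})}{1-z}$ in Ph, $(0,1)\mapsto\infty$. $\mathrm{DW}^{\mathbb R}_{\mathrm{Ph}}(A)$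 is the image of $\mathrm{DW}^{\mathbb R}_{\mathrm{BCK}}(A)$, and all hyperbolic notions below, given in BCK, are transported to the other models by these bijections. For $\lambda\in\mathbb C$, $\iota^{[2]}_{\mathrm{BCK}}(\lambda)=\left(\frac{2\mathrm{Re}\lambda}{|\lambda|^2+1},\frac{|\lambda|^2-1}{|\lambda|^2+1}\right)$, $\iota^{[2]}_{\mathrm{pCK}}(\lambda)=(\mathrm{Re}\lambda,|\lambda|^2)$, $\iota^{[2]}_{\mathrm{Ph}}(\lambda)=(\mathrm{Re}\lambda,|\mathrm{Im}\lambda|)$. Hyperbolic distance of ordinary points in BCK: $\mathrm d(v,w)=\mathrm{arcosh}\frac{1-\langle v,w\rangle}{\sqrt{1-|v|^2}\sqrt{1-|w|^2}}$. In BCK: an $h$-segment is a Euclidean closed segment between two ordinary points; an asymptotically closed $h$-line is a closed chord of the unit disk (the $h$-line is the chord without its endpoints); an asymptotically closed $h$-half-line is a closed segment between an ordinary point and an asymptotic point. An $h$-disk is $\{v \text{ ordinary}: \mathrm d(P,v)\le r\}$ with $P$ ordinary, $0<r<\infty$. An asymptotically closed $h$-distance band around an $h$-line $l$ is $\{v\text{ ordinary}:\mathrm d(v,l)\le r\}$, $0<r<\infty$, together with the two asymptotic points of $l$. An asymptotically closed $h$-horodisk with asymptotic point $p$ ($|p|=1$) is $\{v: |v|^2-1+c(\langle v,p\rangle-1)^2\le0\}$ with some $c>0$. A proper $h$-elliptical disk is a non-degenerate (filled) Euclidean elliptical disk contained in the open unit disk which is not an $h$-disk. An $h$-elliptic parabolic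 disk is a non-degenerate (filled) Euclidean elliptical disk contained in the closed unit disk having exactly one point on the unit circle (its asymptotic point) and which is not an asymptotically closed $h$-horodisk. *)

(* Defs.v *)
From HB Require Import structures.
From mathcomp Require Import all_boot all_order all_algebra.
From mathcomp Require Import all_classical all_reals all_analysis.
From mathcomp Require Export sesquilinear.
From mathcomp Require Export complex.

Set Implicit Arguments.
Unset Strict Implicit.
Unset Printing Implicit Defensive.

Import Order.TTheory GRing.Theory Num.Theory.
Import numFieldNormedType.Exports.
Local Open Scope classical_set_scope.
Local Open Scope ring_scope.

Local Notation Re := complex.Re.
Local Notation Im := complex.Im.

(** * Plane geometry *)

Definition dotp (R : realType) (v w : R * R) : R := v.1 * w.1 + v.2 * w.2.

Definition sqnorm (R : realType) (v : R * R) : R := dotp v v.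

Definition affine_comb (R : realType) (v w : R * R) (t : R) : R * R :=
  ((1 - t) * v.1 + t * w.1, (1 - t) * v.2 + t * w.2).

Definition closed_segment (R : realType) (v w : R * R) : set (R * R) :=
  [set affine_comb v w t | t in `[0, 1]%classic].

Definition open_segment (R : realType) (v w : R * R) : set (R * R) :=
  [set affine_comb v w t | t in `]0, 1[%classic].

(* Centre [c], semi-axes [a] along the unit vector [u] and [b] along [u]
   rotated by a right angle. *)
Definition elliptical_disk (R : realType) (c u : R * R) (a b : R)
    : set (R * R) :=
  [set v | (dotp (v - c) u / a) ^+ 2 + (dotp (v - c) (- u.2, u.1) / b) ^+ 2
           <= 1].

Definition is_elliptical_disk (R : realType) (S : set (R * R)) : Prop :=
  exists c u a b,
    [/\ sqnorm u = 1, 0 < a, 0 < b & S = elliptical_disk c u a b].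

(** * The BCK model *)

Definition ordinary (R : realType) (v : R * R) : Prop := sqnorm v < 1.

Definition asymptotic (R : realType) (v : R * R) : Prop := sqnorm v = 1.

(* Only meaningful for [1 <= x]. *)
Definition arcosh (R : realType) (x : R) : R := ln (x + Num.sqrt (x ^+ 2 - 1)).

Definition hdist (R : realType) (v w : R * R) : R :=
  arcosh ((1 - dotp v w) / (Num.sqrt (1 - sqnorm v) * Num.sqrt (1 - sqnorm w))).

Definition hdist_set (R : realType) (v : R * R) (l : set (R * R)) : R :=
  inf [set hdist v w | w in l].

Definition hsegment_spec (R : realType) (v w : R * R) (S : set (R * R)) : Prop :=
  [/\ ordinary v, ordinary w, v <> w & S = closed_segment v w].

Definition ac_hline_spec (R : realType) (v w : R * R) (S : set (R * R)) : Prop :=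
  [/\ asymptotic v, asymptotic w, v <> w & S = closed_segment v w].

Definition ac_half_hline_spec (R : realType) (v w : R * R) (S : set (R * R))
    : Prop :=
  [/\ ordinary v, asymptotic w & S = closed_segment v w].

Definition hdisk (R : realType) (S : set (R * R)) : Prop :=
  exists P r, [/\ ordinary P, 0 < r &
    S = [set v | ordinary v /\ hdist P v <= r]].

(* The [h]-line is given by its two asymptotic points [p] and [q]. *)
Definition ac_hband (R : realType) (p q : R * R) (S : set (R * R)) : Prop :=
  [/\ asymptotic p, asymptotic q, p <> q &
    exists2 r, 0 < r &
      S = [set v | ordinary v /\ hdist_set v (open_segment p q) <= r]
          `|` [set p; q]].

Definition ac_horodisk (R : realType) (p : R * R) (S : set (R * R)) : Prop :=
  asymptotic p /\
  exists2 c, 0 < c &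
    S = [set v | sqnorm v - 1 + c * (dotp v p - 1) ^+ 2 <= 0].

Definition proper_helliptical_disk (R : realType) (S : set (R * R)) : Prop :=
  [/\ is_elliptical_disk S, S `<=` @ordinary R & ~ hdisk S].

Definition helliptic_parabolic_disk (R : realType) (p : R * R)
    (S : set (R * R)) : Prop :=
  [/\ is_elliptical_disk S,
      S `<=` [set v | sqnorm v <= 1],
      S `&` @asymptotic R = [set p] &
      ~ exists q, ac_horodisk q S].

(** * The three models *)

Inductive model := BCK | pCK | Ph.

(* [None] is the point at infinity of pCK and Ph. *)
Definition point (R : realType) (M : model) : Type :=
  match M with
  | BCK => (R * R)%type
  | pCK | Ph => option (R * R)
  end.

Definition carrier (R : realType) (M : model) : set (point R M) :=
  match M return set (point R M) with
  | BCK => [set v | sqnorm v <= 1]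
  | pCK => [set p | if p is Some (x, z) then x ^+ 2 <= z else True]
  | Ph => [set p | if p is Some (x, z) then 0 <= z else True]
  end.

Arguments carrier R M _ : clear implicits.

Definition bck_of_pck (R : realType) (p : option (R * R)) : R * R :=
  if p is Some (x, z) then (2 * x / (z + 1), (z - 1) / (z + 1)) else (0, 1).

Definition ph_of_bck (R : realType) (v : R * R) : option (R * R) :=
  if v.2 == 1 then None
  else Some (v.1 / (1 - v.2), Num.sqrt (1 - sqnorm v) / (1 - v.2)).

(* The graph of the canonical bijection from the model [M] to BCK. *)
Definition canonical (R : realType) (M : model) : point R M -> R * R -> Prop :=
  match M return point R M -> R * R -> Prop with
  | BCK => fun p v => sqnorm v <= 1 /\ v = p
  | pCK => fun p v => carrier R pCK p /\ v = bck_of_pck p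
  | Ph => fun p v => sqnorm v <= 1 /\ p = ph_of_bck v
  end.

Arguments canonical {R M} p v.

Definition to_bck (R : realType) (M : model) (S : set (point R M))
    : set (R * R) :=
  [set v | exists2 p, S p & canonical p v].

(* A notion given in BCK holds in [M] when it holds of the corresponding points
   and sets of BCK; the inclusion ensures that [to_bck] forgets nothing. *)
Definition transport0 (R : realType) (N : set (R * R) -> Prop) (M : model)
    (S : set (point R M)) : Prop :=
  S `<=` carrier R M /\ N (to_bck S).

Definition transport1 (R : realType) (N : R * R -> set (R * R) -> Prop)
    (M : model) (p : point R M) (S : set (point R M)) : Prop :=
  S `<=` carrier R M /\ exists2 v, canonical p v & N v (to_bck S).

Definition transport2 (R : realType) (N : R * R -> R * R -> set (R * R) -> Prop)
    (M : model) (p q : point R M) (S : set (point R M)) : Prop :=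
  S `<=` carrier R M /\
  exists v w, [/\ canonical p v, canonical q w & N v w (to_bck S)].

Definition is_ordinary (R : realType) (M : model) (p : point R M) : Prop :=
  exists2 v, canonical p v & ordinary v.

Definition is_asymptotic (R : realType) (M : model) (p : point R M) : Prop :=
  exists2 v, canonical p v & asymptotic v.

Definition is_interior (R : realType) (M : model) :=
  transport1 (fun (v : R * R) S => interior S v) (M := M).

Definition is_hsegment (R : realType) (M : model) :=
  transport2 (@hsegment_spec R) (M := M).

Definition is_ac_hline (R : realType) (M : model) :=
  transport2 (@ac_hline_spec R) (M := M).

Definition is_ac_half_hline (R : realType) (M : model) :=
  transport2 (@ac_half_hline_spec R) (M := M).

Definition is_hdisk (R : realType) (M : model) :=
  transport0 (@hdisk R) (M := M).

Definition is_ac_hband (R : realType) (M : model) :=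
  transport2 (@ac_hband R) (M := M).

Definition is_ac_horodisk (R : realType) (M : model) :=
  transport1 (@ac_horodisk R) (M := M).

Definition is_proper_helliptical_disk (R : realType) (M : model) :=
  transport0 (@proper_helliptical_disk R) (M := M).

Definition is_helliptic_parabolic_disk (R : realType) (M : model) :=
  transport1 (@helliptic_parabolic_disk R) (M := M).

(** * Operators *)

(* [dot] is linear in its first argument; completeness is automatic in finite
   dimension. *)
Definition is_adjoint (R : realType) (V : vectType R[i])
    (dot : {dot V for Num.conj}) (A B : 'End(V)) : Prop :=
  forall x y, dot (A x) y = dot x (B y).

Definition is_normal (R : realType) (V : vectType R[i])
    (dot : {dot V for Num.conj}) (A : 'End(V)) : Prop :=
  exists2 B : 'End(V), is_adjoint dot A B & (A \o B = B \o A)%VF.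

Definition char_poly_end (R : realType) (V : vectType R[i]) (A : 'End(V))
    : {poly R[i]} :=
  char_poly (passmx.mxof (vbasis {:V}) (vbasis {:V}) A).

(* On a 2-dimensional space, [l1] and [l2] are the eigenvalues of [A], counted
   with algebraic multiplicity. *)
Definition eigenvalues (R : realType) (V : vectType R[i]) (A : 'End(V))
    (l1 l2 : R[i]) : Prop :=
  char_poly_end A = ('X - l1%:P) * ('X - l2%:P).

(** * The conformal range *)

Definition sqmodc (R : realType) (l : R[i]) : R := Re (`|l| ^+ 2).

Definition iota2 (R : realType) (M : model) (l : R[i]) : point R M :=
  match M return point R M with
  | BCK => (2 * Re l / (sqmodc l + 1), (sqmodc l - 1) / (sqmodc l + 1))
  | pCK => Some (Re l, sqmodc l)
  | Ph => Some (Re l, `|Im l|)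
  end.

Definition DW_BCK (R : realType) (V : vectType R[i])
    (dot : {dot V for Num.conj}) (A : 'End(V)) : set (R * R) :=
  [set v | exists x y : V, [/\ y = A x, x != 0 &
    v = (2 * Re (dot y x) / (Re (dot y y) + Re (dot x x)),
         (Re (dot y y) - Re (dot x x)) / (Re (dot y y) + Re (dot x x)))]].

Definition DW_pCK (R : realType) (V : vectType R[i])
    (dot : {dot V for Num.conj}) (A : 'End(V)) : set (option (R * R)) :=
  [set p | exists x y : V, [/\ y = A x, x != 0 &
    p = Some (Re (dot y x) / Re (dot x x), Re (dot y y) / Re (dot x x))]].

Definition DW (R : realType) (V : vectType R[i])
    (dot : {dot V for Num.conj}) (M : model) (A : 'End(V)) : set (point R M) :=
  match M return set (point R M) with
  | BCK => DW_BCK dot A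
  | pCK => DW_pCK dot A
  | Ph => @ph_of_bck R @` DW_BCK dot A
  end.

Arguments DW {R V} dot M A _.

(* Main.v *)
From HB Require Import structures.
Require Import Defs.
From mathcomp Require Import all_boot all_order all_algebra.
From mathcomp Require Import all_classical all_reals all_analysis.
From mathcomp Require Import ring lra.

Set Implicit Arguments.
Unset Strict Implicit.
Unset Printing Implicit Defensive.

Import Order.TTheory GRing.Theory Num.Theory.
Local Open Scope classical_set_scope.
Local Open Scope ring_scope.

(** Choose an orthonormal basis e1, e2 in which A is upper triangular, with
    diagonal l1, l2 and a real off-diagonal entry t; A is normal exactly when
    t = 0 ([schur_decomposition]).  On a unit vector x = a e1 + b e2 both
    Re <Ax, x> and |Ax|^2 are affine functions of the Hopf coordinates
    s = |a|^2 - |b|^2, u + i v = 2 conj(a) b, which run over the whole unit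
    sphere.  So the range in pCK is the image of a sphere of R^3 under an affine
    map to the plane ([DW_pCK_sphere_image]).

    For t = 0 the map depends on s only, and the image is the segment joining
    the points of the two eigenvalues.  The passage to BCK is projective, hence
    turns it into the segment between the images of these points; it is a point,
    an h-segment, a half-line or a line according to whether the ends coincide
    and whether they lie on the unit circle.

    For t <> 0 the linear part has rank 2, its kernel is spanned by the cross
    product of its rows, and the image is the set where a quadratic polynomial
    is nonpositive ([sphere_image_rangeE]).  Let Q be the absolute form, which
    is z - x^2 in pCK and 1 - |v|^2 in BCK, let P1, P2 be the polars of the
    points of the eigenvalues, and let m be the line through these two points.
    The polynomial is then

      m^2 + t^2 (P1 P2 - (2 (a1 - a2)^2 + 2 b1^2 + 2 b2^2 + t^2) Q),

    where lj = aj + i bj, and the classification is read off from it.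
    - In BCK it is positive definite at infinity, so the range is an elliptical
      disk; its value at the point of lj is a negative multiple of bj^2, so the
      point of a non-real eigenvalue is interior.
    - On the circle Q = 0 the polynomial is positive, except at the point of a
      real eigenvalue.
    - If l2 is l1 or its conjugate, then m = 0 and P1 = P2, so the range is
      P1^2 <= k Q.  This is the inequality cosh d(p, v) <= cosh r squared, or
      that of a horodisk when the point p of l1 is asymptotic ([disk_form]).
    - If both eigenvalues are real, then m^2 is a combination of P1 P2 and Q, so
      the range is P1 P2 <= k Q.  By the inequality between arithmetic and
      geometric means this bounds the distance from a chord
      ([hdist_set_chord]).
    - Conversely, if the range is some P^2 <= k Q, the two quadratic polynomials
      are proportional ([same_sublevel_proportional]), so the pencil spanned by
      the equation of the range and Q contains the square of a linear form.  The
      minors of a matrix of rank one then leave only equal or conjugate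
      eigenvalues, or two real ones ([range_form_square_pencil]). *)

(** * Upper triangular form of an operator on a plane *)

Section CharacteristicRoots.
Import passmx.

Lemma root_char_poly_end (R : realType) (V : vectType R[i]) (A : 'End(V))
    (l : R[i]) :
  root (char_poly_end A) l <-> exists2 x, x != 0 & A x = l *: x.
Proof.
have Vb := vbasisP {:V}; rewrite -eigenvalue_root_char; split.
  move=> /eigenvalueP[v vA v0].
  exists (vecof (vbasis {:V}) v); first by rewrite vecof_eq0.
  by rewrite (hom_vecof _ Vb) vA linearZ.
move=> [x x0 Ax]; apply/eigenvalueP.
exists (rVof (vbasis {:V}) x); last by rewrite rVof_eq0.
by rewrite -(rVof_app _ Vb) Ax linearZ.
Qed.

End CharacteristicRoots.

Section DotProduct.
Variables (R : realType) (V : vectType R[i]) (dot : {dot V for Num.conj}).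

Lemma dotDl x y z : dot (x + y) z = dot x z + dot y z.
Proof. exact: linearDl. Qed.

Lemma dotDr x y z : dot z (x + y) = dot z x + dot z y.
Proof. exact: linearDr. Qed.

Lemma dotZl a x z : dot (a *: x) z = a * dot x z.
Proof. exact: linearZl_LR. Qed.

Lemma dotZr a x z : dot z (a *: x) = conjc a * dot z x.
Proof. exact: linearZr_LR. Qed.

Lemma dotC x y : dot x y = conjc (dot y x).
Proof. by rewrite hermC expr0 mul1r. Qed.

Lemma dot_gt0 x : x != 0 -> 0 < dot x x.
Proof. exact: neq0_dnorm_gt0. Qed.

Lemma dot0l x : dot 0 x = 0.
Proof. by rewrite -(scale0r 0) dotZl mul0r. Qed.

Lemma normalize_vector x : x != 0 ->
  exists2 c : R[i], c != 0 & dot (c *: x) (c *: x) = 1.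
Proof.
move=> /dot_gt0; rewrite ltcE => /andP[/eqP im0 re0].
have dE : dot x x = (complex.Re (dot x x))%:C%C.
  by rewrite [LHS]complexE im0 mulr0 addr0.
set d := complex.Re (dot x x) in dE re0.
have s0 : Num.sqrt d != 0 by rewrite sqrtr_eq0 -ltNge.
exists ((Num.sqrt d)^-1)%:C%C; first by rewrite fmorph_eq0 invr_eq0.
rewrite dotZl dotZr conjc_real dE -!rmorphM -(rmorph1 (real_complex R)).
congr (real_complex R _); rewrite -[X in _ * (_ * X)]sqr_sqrtr ?ltW//.
by field.
Qed.

Hypothesis dimV : \dim {:V} = 2%N.
Variables e1 e2 : V.
Hypotheses (e11 : dot e1 e1 = 1) (e22 : dot e2 e2 = 1) (e12 : dot e1 e2 = 0).

Lemma orthonormal_dotC : dot e2 e1 = 0.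
Proof. by rewrite dotC e12 conjc0. Qed.

Lemma orthonormal_decomp x : x = dot x e1 *: e1 + dot x e2 *: e2.
Proof.
have e21 := orthonormal_dotC.
have indep a b : a *: e1 + b *: e2 = 0 -> a = 0 /\ b = 0.
  move=> ab; split.
    have := congr1 (dot ^~ e1) ab.
    by rewrite dotDl !dotZl e11 e21 mulr1 mulr0 addr0 dot0l.
  have := congr1 (dot ^~ e2) ab.
  by rewrite dotDl !dotZl e22 e12 mulr1 mulr0 add0r dot0l.
have : x \in (<[e1]> + <[e2]>)%VS.
  suff -> : (<[e1]> + <[e2]>)%VS = fullv by rewrite memvf.
  apply/eqP; rewrite eqEdim subvf dimV /= dimv_disjoint_sum.
    have e1n : e1 != 0.
      by apply/eqP => e; move: e11; rewrite e dot0l => /esym/eqP; rewrite oner_eq0.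
    have e2n : e2 != 0.
      by apply/eqP => e; move: e22; rewrite e dot0l => /esym/eqP; rewrite oner_eq0.
    by rewrite !dim_vline e1n e2n.
  apply/eqP; rewrite -subv0; apply/subvP => v; rewrite memv_cap memv0.
  move=> /andP[/vlineP[a ->] /vlineP[b /eqP]]; rewrite -subr_eq0 -scaleNr.
  by move=> /eqP/indep[-> _]; rewrite scale0r.
move=> /memv_addP[u /vlineP[a ->] [v /vlineP[b ->] ->]].
by rewrite !dotDl !dotZl e11 e22 e12 e21 !mulr1 !mulr0 addr0 add0r.
Qed.

End DotProduct.

Section Schur.
Variables (R : realType) (V : vectType R[i]) (dot : {dot V for Num.conj}).
Hypothesis dimV : \dim {:V} = 2%N.
Variable A : 'End(V).

Lemma unimodular_phase (z : R[i]) :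
  exists (c : R[i]) (t : R), c * conjc c = 1 /\ c * z = t%:C%C.
Proof.
have [->|z0] := eqVneq z 0.
  by exists 1, 0; rewrite conjc1 mulr1 mulr0 rmorph0.
(* The real part only changes the type of the modulus. *)
exists (`|z| / z), (complex.Re `|z|); split.
- by rewrite -sqr_normc normrM normrV ?unitfE// normr_id divff ?normr_eq0// expr1n.
- by rewrite mulfVK// normc_def.
Qed.

(** If A is normal, then it is as long on e1 as its adjoint, and the squared
    lengths are |l1|^2 and |l1|^2 + |t|^2.  If t = 0, the conjugate diagonal
    matrix is the adjoint and commutes with A. *)
Lemma is_normal_upper_triangular (e1 e2 : V) (l1 t m : R[i]) :
  dot e1 e1 = 1 -> dot e2 e2 = 1 -> dot e1 e2 = 0 ->
  A e1 = l1 *: e1 -> A e2 = t *: e1 + m *: e2 ->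
  is_normal dot A <-> t = 0.
Proof.
move=> e11 e22 e12 Ae1 Ae2.
have e21 := orthonormal_dotC e12.
have dec := orthonormal_decomp dimV e11 e22 e12.
split=> [[B adj com] | t0].
  have Be1 : B e1 = conjc l1 *: e1 + conjc t *: e2.
    rewrite {1}(dec (B e1)) (dotC _ (B e1) e1) (dotC _ (B e1) e2) -!adj.
    by rewrite Ae1 Ae2 dotDl !dotZl e11 e21 !mulr1 !mulr0 !addr0.
  have : dot (A e1) (A e1) = dot (B e1) (B e1).
    rewrite adj -comp_lfunE -com comp_lfunE.
    by rewrite dotC adj -dotC.
  rewrite Ae1 Be1 !(dotDl, dotDr, dotZl, dotZr) e11 e12 e21 e22 !conjcK.
  rewrite !mulr1 !mulr0 !(addr0, add0r) mulrC => /eqP.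
  rewrite -subr_eq0 opprD addrA subrr sub0r oppr_eq0 mulf_eq0 conjc_eq0.
  by rewrite orbb => /eqP.
pose f x := (conjc l1 * dot x e1) *: e1 + (conjc m * dot x e2) *: e2.
have fl : linear f.
  move=> a x y; rewrite /f !dotDl !dotZl !mulrDr !scalerDl scalerDr !scalerA.
  by rewrite ![conjc _ * (a * _)]mulrCA addrACA.
pose F : {linear V -> V} := HB.pack f (GRing.isLinear.Build _ _ _ _ f fl).
pose B : 'End(V) := linfun F.
have BE x : B x = f x by rewrite lfunE.
exists B.
  move=> x y; rewrite BE {1}(dec x) linearD !linearZ /= Ae1 Ae2 t0 scale0r add0r.
  rewrite /f !(dotDl, dotDr, dotZl, dotZr) (dotC _ e1 y) (dotC _ e2 y).
  rewrite !rmorphM /= !conjcK.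
  ring.
have AE x : A x = (l1 * dot x e1) *: e1 + (m * dot x e2) *: e2.
  rewrite {1}(dec x) linearD !linearZ /= Ae1 Ae2 t0 scale0r add0r !scalerA.
  by congr (_ *: _ + _ *: _); rewrite mulrC.
apply/lfunP => x; rewrite !comp_lfunE !BE !AE /f.
rewrite !(dotDl, dotZl) e11 e12 e21 e22 !(mulr0, mulr1, addr0, add0r).
by congr (_ *: _ + _ *: _); rewrite mulrCA.
Qed.

(** A unit eigenvector of l1 is completed to an orthonormal basis.  The other
    diagonal entry m is an eigenvalue, so it is l1 or l2; and if m = l1 <> l2,
    then A - l2 would be triangular with nonzero diagonal, hence injective.  A
    phase factor on e2 makes the off-diagonal entry real. *)
Lemma schur_decomposition (l1 l2 : R[i]) : eigenvalues A l1 l2 ->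
  exists (e1 e2 : V) (t : R),
   [/\ [/\ dot e1 e1 = 1, dot e2 e2 = 1 & dot e1 e2 = 0],
       A e1 = l1 *: e1, A e2 = t%:C%C *: e1 + l2 *: e2 &
       is_normal dot A <-> t = 0].
Proof.
move=> eig.
have rootE z : root (char_poly_end A) z = (z == l1) || (z == l2).
  by rewrite eig rootM !root_XsubC.
have /root_char_poly_end[x x0 Ax] : root (char_poly_end A) l1.
  by rewrite rootE eqxx.
have [c c0 e11] := normalize_vector dot x0.
set e1 := c *: x in e11.
have Ae1 : A e1 = l1 *: e1 by rewrite linearZ /= Ax !scalerA mulrC.
have e1n : e1 != 0 by rewrite scaler_eq0 negb_or c0.
have [y yN] : exists y, y \notin <[e1]>%VS.
  apply: contrapT => /forallNP H; have : (fullv <= <[e1]>)%VS.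
    by apply/subvP => y _; apply: contrapT => /negP/H.
  by move=> /dimvS; rewrite dimV dim_vline e1n.
have y'0 : y - dot y e1 *: e1 != 0.
  apply: contra yN; rewrite subr_eq0 => /eqP->.
  by rewrite memvZ ?memv_line.
have [d d0 e22] := normalize_vector dot y'0.
set e2 := d *: _ in e22.
have e21 : dot e2 e1 = 0.
  by rewrite /e2 dotZl -scaleNr dotDl dotZl e11 mulr1 subrr mulr0.
have e12 : dot e1 e2 = 0 by rewrite dotC e21 conjc0.
have dec := orthonormal_decomp dimV e11 e22 e12.
clearbody e2; clear d d0; clearbody e1.
have Ae2 := dec (A e2).
move: (dot (A e2) e1) (dot (A e2) e2) Ae2 => t m Ae2.
have mE : m = l2.
  have m_root : root (char_poly_end A) m.
    apply/root_char_poly_end; have [ml|ml] := eqVneq m l1.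
      by exists e1; rewrite ?ml.
    exists (t *: e1 + (m - l1) *: e2); last first.
      rewrite linearD !linearZ /= Ae1 Ae2 !scalerDr !scalerA addrA -scalerDl.
      by congr (_ *: _ + _ *: _); ring.
    apply: contra_neq ml => /(congr1 (dot ^~ e2)) /eqP.
    rewrite dot0l dotDl !dotZl e12 e22 mulr0 mulr1 add0r subr_eq0.
    by move=> /eqP.
  have [l12|l12] := eqVneq l1 l2.
    by move: m_root; rewrite rootE l12 orbb => /eqP.
  move: m_root; rewrite rootE => /orP[]/eqP // ml.
  have /root_char_poly_end[w w0 Aw] : root (char_poly_end A) l2.
    by rewrite rootE eqxx orbT.
  have l21 : l1 - l2 != 0 by rewrite subr_eq0.
  have w2 : dot w e2 = 0.
    have := congr1 (dot ^~ e2) Aw.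
    rewrite {1}(dec w) linearD !linearZ /= Ae1 Ae2 ml.
    rewrite !(dotDl, dotZl) e12 e22 !mulr0 !(add0r, mulr1) => /eqP.
    by rewrite mulrC -subr_eq0 -mulrBl mulf_eq0 (negPf l21) => /eqP.
  have w1 : dot w e1 = 0.
    have := congr1 (dot ^~ e1) Aw.
    rewrite {1}(dec w) w2 scale0r addr0 linearZ /= Ae1.
    rewrite !dotZl e11 mulr1 => /eqP.
    by rewrite mulrC -subr_eq0 -mulrBl mulf_eq0 (negPf l21) => /eqP.
  by move: w0; rewrite (dec w) w1 w2 !scale0r addr0 eqxx.
rewrite {}mE {m} in Ae2.
have [p [r [pp pt]]] := unimodular_phase t.
have e22' : dot (p *: e2) (p *: e2) = 1 by rewrite dotZl dotZr e22 mulr1.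
have e12' : dot e1 (p *: e2) = 0 by rewrite dotZr e12 mulr0.
have Ae2' : A (p *: e2) = r%:C%C *: e1 + l2 *: (p *: e2).
  by rewrite linearZ /= Ae2 scalerDr !scalerA pt [p * l2]mulrC.
exists e1, (p *: e2), r; split => //.
rewrite (is_normal_upper_triangular e11 e22' e12' Ae1 Ae2').
by split=> [/eqP|->]; rewrite ?rmorph0// fmorph_eq0 => /eqP.
Qed.

End Schur.

(** * The range as the image of a sphere *)

Section SpherePicture.
Variable R : realType.

(** The point of pCK given by the unit vector a e1 + b e2, as a function of its
    Hopf coordinates s = |a|^2 - |b|^2 and u + i v = 2 conj(a) b.  Here A is
    upper triangular with diagonal a1 + i b1, a2 + i b2 and corner t. *)
Definition sphere_point (a1 b1 a2 b2 t s u v : R) : R * R :=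
  ((a1 + a2 + s * (a1 - a2) + t * u) / 2,
   (a1 ^+ 2 + b1 ^+ 2 + a2 ^+ 2 + b2 ^+ 2 + t ^+ 2
    + s * (a1 ^+ 2 + b1 ^+ 2 - a2 ^+ 2 - b2 ^+ 2 - t ^+ 2)) / 2
   + t * (a1 * u + b1 * v)).

Definition sphere_image (a1 b1 a2 b2 t : R) : set (R * R) :=
  [set p | exists s u v, s ^+ 2 + u ^+ 2 + v ^+ 2 = 1 /\
                         p = sphere_point a1 b1 a2 b2 t s u v].

(** This is the Cauchy-Schwarz inequality Re <y, x>^2 <= |x|^2 |y|^2.  The gap is
    (Im <y, x>)^2 + |x1 y2 - x2 y1|^2, which becomes a visible sum of squares
    after multiplication by 1 + s = 2 |x1|^2. *)
Lemma sphere_image_above_parabola (a1 b1 a2 b2 t : R) p :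
  sphere_image a1 b1 a2 b2 t p -> p.1 ^+ 2 <= p.2.
Proof.
move=> [s [u [v [suv ->]]]] /=.
have s1 : s ^+ 2 <= 1 by rewrite -suv -addrA lerDl addr_ge0 ?sqr_ge0.
have sN1 : -1 <= s by move: s1; nra.
have sP1 : s <= 1 by move: s1; nra.
rewrite -subr_ge0; set Q := _ - _.
have [s0|s0] := ltP 0 (1 + s).
  rewrite -(pmulr_rge0 _ s0).
  have -> : (1 + s) * Q =
     (1 + s) * ((b1 * (1 + s) + b2 * (1 - s) + t * v) / 2) ^+ 2
     + (1 - s) / 4 * (((1 + s) * (a1 - a2) + t * u) ^+ 2
                      + ((1 + s) * (b1 - b2) + t * v) ^+ 2)
     + t ^+ 2 / 2 * (1 - (s ^+ 2 + u ^+ 2 + v ^+ 2)).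
    by rewrite /Q; field.
  rewrite suv subrr mulr0 addr0 addr_ge0// mulr_ge0 ?sqr_ge0 ?(ltW s0)//.
    by rewrite divr_ge0 ?subr_ge0.
  by rewrite addr_ge0 ?sqr_ge0.
(* The remaining point of the sphere belongs to x = e2. *)
have sE : s = -1 by lra.
have := suv; rewrite sE sqrrN expr1n => uv.
have u0 : u = 0 by apply/eqP; rewrite -sqrf_eq0; move: (sqr_ge0 u) (sqr_ge0 v); lra.
have v0 : v = 0 by apply/eqP; rewrite -sqrf_eq0; move: (sqr_ge0 u) (sqr_ge0 v); lra.
have -> : Q = b2 ^+ 2 + t ^+ 2 by rewrite /Q sE u0 v0; field.
by rewrite addr_ge0 ?sqr_ge0.
Qed.

(** For t = 0 the coordinates u and v drop out, and s runs over [-1, 1]. *)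
Lemma sphere_image_normal (a1 b1 a2 b2 : R) :
  sphere_image a1 b1 a2 b2 0 =
  closed_segment (a1, a1 ^+ 2 + b1 ^+ 2) (a2, a2 ^+ 2 + b2 ^+ 2).
Proof.
apply/seteqP; split=> [p [s [u [v [suv ->]]]]|p [w /= w01 <-]].
  have s1 : s ^+ 2 <= 1 by rewrite -suv -addrA lerDl addr_ge0 ?sqr_ge0.
  exists ((1 - s) / 2).
    by rewrite /= in_itv /=; apply/andP; split; move: s1; nra.
  by rewrite /affine_comb /sphere_point /=; congr (_, _); field.
move: w01; rewrite in_itv /= => /andP[w0 w1].
(* Any point of the sphere at height s will do; take v = 0. *)
exists (1 - w * 2), (Num.sqrt (1 - (1 - w * 2) ^+ 2)), 0; split.
  by rewrite sqr_sqrtr ?subr_ge0; [ring | nra].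
by rewrite /affine_comb /sphere_point /=; congr (_, _); field.
Qed.

(** The line through the points (aj, aj^2 + bj^2) of the two eigenvalues, in
    homogeneous coordinates: w = 1 is pCK. *)
Definition line_form (a1 b1 a2 b2 w x z : R) : R :=
  (a1 - a2) * z - (a1 ^+ 2 + b1 ^+ 2 - a2 ^+ 2 - b2 ^+ 2) * x
  + ((a1 ^+ 2 + b1 ^+ 2) * a2 - (a2 ^+ 2 + b2 ^+ 2) * a1) * w.

(** The polar of the point (a, a^2 + b^2) with respect to z w = x^2. *)
Definition polar_form (a b w x z : R) : R :=
  z - 2 * a * x + (a ^+ 2 + b ^+ 2) * w.

(** Equation of the range.  The parabola z w = x^2 is the absolute conic of the
    hyperbolic plane; the homogeneous coordinate w allows the substitution
    w = 1 - v.2, x = v.1, z = 1 + v.2, which leads to BCK. *)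
Definition range_form (a1 b1 a2 b2 t w x z : R) : R :=
  line_form a1 b1 a2 b2 w x z ^+ 2
  + t ^+ 2 * (polar_form a1 b1 w x z * polar_form a2 b2 w x z
     - (2 * (a1 - a2) ^+ 2 + 2 * b1 ^+ 2 + 2 * b2 ^+ 2 + t ^+ 2)
       * (z * w - x ^+ 2)).

(** The vector (normal_s, normal_u, normal_v) spans, for t <> 0, the kernel of the
    linear part of [sphere_point]: it is the cross product of its rows (a1 - a2, t, 0) and
    (e, t a1, t b1), where 2 e = |l1|^2 - |l2|^2 - t^2 and where the first row,
    which carries a factor 1/2, has been doubled. *)
Definition normal_s (a1 b1 a2 b2 t : R) : R := t ^+ 2 * b1.
Definition normal_u (a1 b1 a2 b2 t : R) : R := - (a1 - a2) * t * b1.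
Definition normal_v (a1 b1 a2 b2 t : R) : R :=
  t * ((a1 - a2) ^+ 2 + t ^+ 2 + b2 ^+ 2 - b1 ^+ 2) / 2.

(** Lagrange's identity: for rows r1, r2 with cross product n, the adjugate of
    the Gram matrix of r1, r2, evaluated at (r1.y, r2.y), is
    |n|^2 |y|^2 - (n.y)^2. *)
Lemma range_formE (a1 b1 a2 b2 t s u v : R) :
  let p := sphere_point a1 b1 a2 b2 t s u v in
  let k1 := normal_s a1 b1 a2 b2 t in
  let k2 := normal_u a1 b1 a2 b2 t in
  let k3 := normal_v a1 b1 a2 b2 t in
  range_form a1 b1 a2 b2 t 1 p.1 p.2 =
    (k1 ^+ 2 + k2 ^+ 2 + k3 ^+ 2) * (s ^+ 2 + u ^+ 2 + v ^+ 2 - 1)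
    - (k1 * s + k2 * u + k3 * v) ^+ 2.
Proof.
rewrite /= /range_form /line_form /polar_form /normal_s /normal_u /normal_v.
by field.
Qed.

Lemma normal_gt0 (a1 b1 a2 b2 t : R) : t != 0 ->
  0 < normal_s a1 b1 a2 b2 t ^+ 2 + normal_u a1 b1 a2 b2 t ^+ 2
      + normal_v a1 b1 a2 b2 t ^+ 2.
Proof.
move=> t0; have t2 : 0 < t ^+ 2 by rewrite exprn_even_gt0.
have [b0|b0] := eqVneq b1 0; last first.
  rewrite -addrA ltr_pwDl ?addr_ge0 ?sqr_ge0//.
  by rewrite exprn_even_gt0//= mulf_neq0// expf_neq0.
rewrite ltr_wpDl ?addr_ge0 ?sqr_ge0// exprn_even_gt0//= /normal_v b0.
rewrite mulf_neq0 ?invr_eq0 ?pnatr_eq0// mulf_neq0// expr0n subr0.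
by rewrite lt0r_neq0// ltr_wpDr ?sqr_ge0// ltr_wpDl ?sqr_ge0.
Qed.

(** A point of the plane has a line of preimages, parallel to the normal n.  By
    [range_formE] the preimage y with (n.y)^2 equal to minus the value of
    [range_form] has length one, and it exists when this value is nonpositive. *)
Lemma sphere_image_rangeE (a1 b1 a2 b2 t : R) : t != 0 ->
  sphere_image a1 b1 a2 b2 t =
  [set p | range_form a1 b1 a2 b2 t 1 p.1 p.2 <= 0].
Proof.
move=> t0; have n0 := normal_gt0 a1 b1 a2 b2 t0.
apply/seteqP; split=> [p [s [u [v [suv ->]]]]|[x z] /= Fle0].
  by rewrite /= range_formE suv subrr mulr0 sub0r oppr_le0 sqr_ge0.
set k1 := normal_s a1 b1 a2 b2 t in n0.
set k2 := normal_u a1 b1 a2 b2 t in n0.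
set k3 := normal_v a1 b1 a2 b2 t in n0.
set K := _ + _ in n0.
(* The prescribed value of n.y. *)
pose h := Num.sqrt (- range_form a1 b1 a2 b2 t 1 x z).
(* The preimage is (d (r2 x n) + d' (n x r1) + h n) / |n|^2, by Cramer's rule
   for the system r1.y = d, r2.y = d', n.y = h with rows
   r1 = (a1 - a2, t, 0), r2 = (e, t a1, t b1). *)
pose e := (a1 ^+ 2 + b1 ^+ 2 - a2 ^+ 2 - b2 ^+ 2 - t ^+ 2) / 2.
pose d := 2 * x - (a1 + a2).
pose d' := z - (a1 ^+ 2 + b1 ^+ 2 + a2 ^+ 2 + b2 ^+ 2 + t ^+ 2) / 2.
(* Cramer's rule *)
pose s := d * (t * a1 * k3 - t * b1 * k2) - d' * (k3 * t) + h * k1.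
pose u := d * (t * b1 * k1 - e * k3) + d' * (k3 * (a1 - a2)) + h * k2.
pose v := d * (e * k2 - t * a1 * k1) + d' * (k1 * t - k2 * (a1 - a2)) + h * k3.
have K0 : K != 0 by rewrite gt_eqF.
have dE : (a1 - a2) * s + t * u = d * K.
  rewrite /s /u /K /k1 /k2 /k3 /normal_s /normal_u /normal_v /e; clear.
  by field.
have dE' : e * s + t * a1 * u + t * b1 * v = d' * K.
  rewrite /s /u /v /K /k1 /k2 /k3 /normal_s /normal_u /normal_v /e; clear.
  by field.
have hE : k1 * s + k2 * u + k3 * v = h * K by rewrite /s /u /v /K; clear; ring.
have pE : (x, z) = sphere_point a1 b1 a2 b2 t (s / K) (u / K) (v / K).
  congr (_, _).
    transitivity ((a1 + a2 + ((a1 - a2) * s + t * u) / K) / 2); last by field.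
    by rewrite dE mulfK // /d; field.
  transitivity (((a1 ^+ 2 + b1 ^+ 2 + a2 ^+ 2 + b2 ^+ 2 + t ^+ 2) / 2 +
    (e * s + t * a1 * u + t * b1 * v) / K)); last by rewrite /e; field.
  by rewrite dE' mulfK // /d'; field.
exists (s / K), (u / K), (v / K); split => //.
have := range_formE a1 b1 a2 b2 t (s / K) (u / K) (v / K).
rewrite -pE /= -/k1 -/k2 -/k3 -/K !mulrA -!mulrDl hE mulfK//.
rewrite /h sqr_sqrtr ?oppr_ge0// opprK -[X in X = _]add0r => /addIr/esym/eqP.
by rewrite mulf_eq0 (negPf K0) subr_eq0 => /eqP.
Qed.

Lemma range_form_homogeneous (a1 b1 a2 b2 t c w x z : R) :
  range_form a1 b1 a2 b2 t (c * w) (c * x) (c * z) =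
  c ^+ 2 * range_form a1 b1 a2 b2 t w x z.
Proof. by rewrite /range_form /line_form /polar_form; ring. Qed.

Lemma range_form_infinity (a1 b1 a2 b2 t x z : R) : t != 0 ->
  (x != 0) || (z != 0) -> 0 < range_form a1 b1 a2 b2 t 0 x z.
Proof.
move=> t0 xz; have t2 : 0 < t ^+ 2 by rewrite exprn_even_gt0.
have -> : range_form a1 b1 a2 b2 t 0 x z =
    ((a1 - a2) * z - (a1 ^+ 2 + b1 ^+ 2 - a2 ^+ 2 - b2 ^+ 2) * x) ^+ 2
    + t ^+ 2 * ((z - (a1 + a2) * x) ^+ 2
       + ((a1 - a2) ^+ 2 + 2 * b1 ^+ 2 + 2 * b2 ^+ 2 + t ^+ 2) * x ^+ 2).
  by rewrite /range_form /line_form /polar_form; ring.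
rewrite ltr_wpDl ?sqr_ge0// mulr_gt0//.
have k0 : 0 < (a1 - a2) ^+ 2 + 2 * b1 ^+ 2 + 2 * b2 ^+ 2 + t ^+ 2.
  by move: (sqr_ge0 (a1 - a2)) (sqr_ge0 b1) (sqr_ge0 b2) t2; lra.
have [x0|x0] := eqVneq x 0.
  rewrite x0 eqxx /= in xz.
  by rewrite x0 expr0n !mulr0 addr0 subr0 exprn_even_gt0.
by rewrite ltr_wpDl ?sqr_ge0// mulr_gt0// exprn_even_gt0.
Qed.

(** BCK sends the line z = - w to infinity, and that line does not meet the range,
    which lies above the parabola z w = x^2. *)
Lemma range_form_posdef (a1 b1 a2 b2 t x z : R) : t != 0 ->
  (x != 0) || (z != 0) -> 0 < range_form a1 b1 a2 b2 t (- z) x z.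
Proof.
move=> t0 xz; have [z0|z0] := eqVneq z 0.
  by rewrite z0 in xz *; rewrite oppr0 range_form_infinity.
rewrite ltNge; apply/negP => F0.
have : sphere_image a1 b1 a2 b2 t (- x / z, -1).
  rewrite sphere_image_rangeE//=.
  move: F0; have -> : range_form a1 b1 a2 b2 t (- z) x z =
      (- z) ^+ 2 * range_form a1 b1 a2 b2 t 1 (- x / z) (- 1).
    by rewrite -range_form_homogeneous; congr range_form; field.
  by rewrite pmulr_rle0// exprn_even_gt0//= oppr_eq0.
by move=> /sphere_image_above_parabola /=;
  rewrite leNgt (lt_le_trans (ltrN10 _) (sqr_ge0 _)).
Qed.

(** The point (0, 1) is the only one of BCK without coordinates in pCK; it is
    excluded because [range_form] is positive there. *)
Lemma bck_sphere_image (a1 b1 a2 b2 t : R) : t != 0 ->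
  [set bck_of_pck (Some p) | p in sphere_image a1 b1 a2 b2 t] =
  [set v | range_form a1 b1 a2 b2 t (1 - v.2) v.1 (1 + v.2) <= 0].
Proof.
move=> t0; apply/seteqP; split=> [_ [[x z] /[dup] Kp + <-]|[X Z] /= F0].
  have /= xz := sphere_image_above_parabola Kp.
  have z1 : z + 1 != 0.
    by rewrite gt_eqF// ltr_wpDl//; apply: le_trans xz; rewrite sqr_ge0.
  rewrite sphere_image_rangeE //= => F0.
  have -> : 1 - (z - 1) / (z + 1) = 2 / (z + 1) * 1 by field.
  have -> : 1 + (z - 1) / (z + 1) = 2 / (z + 1) * z by field.
  have -> : 2 * x / (z + 1) = 2 / (z + 1) * x by field.
  by rewrite range_form_homogeneous mulr_ge0_le0 ?sqr_ge0.
have Z1 : 1 - Z != 0.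
  apply: contraTN F0 => /eqP Z1; rewrite Z1 -ltNge range_form_infinity//.
  by apply/orP; right; apply/eqP => Z2; move: Z1 Z2; lra.
exists (X / (1 - Z), (1 + Z) / (1 - Z)); last first.
  have Z2 : 1 + Z + (1 - Z) != 0.
    by rewrite (_ : 1 + Z + (1 - Z) = 2) ?pnatr_eq0//; ring.
  by rewrite /=; congr (_, _); field; rewrite Z1 Z2.
rewrite sphere_image_rangeE//=; move: F0.
have -> : range_form a1 b1 a2 b2 t (1 - Z) X (1 + Z) =
    (1 - Z) ^+ 2 * range_form a1 b1 a2 b2 t 1 (X / (1 - Z)) ((1 + Z) / (1 - Z)).
  by rewrite -range_form_homogeneous; congr range_form; field.
by rewrite pmulr_rle0// exprn_even_gt0.
Qed.

End SpherePicture.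

Section RangeFromSphere.
Variables (R : realType) (V : vectType R[i]) (dot : {dot V for Num.conj}).
Hypothesis dimV : \dim {:V} = 2%N.
Variables (A : 'End(V)) (e1 e2 : V) (l1 l2 : R[i]) (t : R).
Hypotheses (e11 : dot e1 e1 = 1) (e22 : dot e2 e2 = 1) (e12 : dot e1 e2 = 0).
Hypotheses (Ae1 : A e1 = l1 *: e1) (Ae2 : A e2 = t%:C%C *: e1 + l2 *: e2).

Lemma dot_orthonormal a b c d :
  dot (a *: e1 + b *: e2) (c *: e1 + d *: e2) = a * conjc c + b * conjc d.
Proof.
rewrite !(dotDl, dotDr, dotZl, dotZr) e11 e22 e12 (orthonormal_dotC e12).
by rewrite !mulr0 !mulr1 addr0 add0r.
Qed.

(** The Hopf map sends the unit vectors onto the unit sphere. *)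
Lemma DW_pCK_sphere_image :
  DW_pCK dot A =
  [set Some p | p in sphere_image (complex.Re l1) (complex.Im l1)
                                  (complex.Re l2) (complex.Im l2) t].
Proof.
have AE a b : A (a *: e1 + b *: e2) =
    (l1 * a + t%:C%C * b) *: e1 + (l2 * b) *: e2.
  rewrite linearD !linearZ /= Ae1 Ae2 scalerDr !scalerA addrA -scalerDl.
  by congr (_ *: _ + _ *: _); [rewrite mulrC [b * _]mulrC | rewrite mulrC].
clear Ae1 Ae2; case: l1 AE => a1 b1; case: l2 => a2 b2 AE.
pose N (p1 p2 q1 q2 : R) := p1 ^+ 2 + p2 ^+ 2 + q1 ^+ 2 + q2 ^+ 2.
have hopf p1 p2 q1 q2 (x := (p1 +i* p2)%C *: e1 + (q1 +i* q2)%C *: e2) :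
    N p1 p2 q1 q2 != 0 ->
    (complex.Re (dot (A x) x) / complex.Re (dot x x),
     complex.Re (dot (A x) (A x)) / complex.Re (dot x x)) =
    sphere_point a1 b1 a2 b2 t
      ((p1 ^+ 2 + p2 ^+ 2 - q1 ^+ 2 - q2 ^+ 2) / N p1 p2 q1 q2)
      (2 * (p1 * q1 + p2 * q2) / N p1 p2 q1 q2)
      (2 * (p1 * q2 - p2 * q1) / N p1 p2 q1 q2).
  rewrite /x AE !dot_orthonormal /sphere_point /N /= => N0.
  by congr (_, _); field; apply: contra_neq N0 => <-; ring.
apply/seteqP; split=> [q [x [_ [-> x0 ->]]] | _ [_ [s [u [v [suv ->]]]] <-]] /=.
  move: x0; rewrite (orthonormal_decomp dimV e11 e22 e12 x).
  move: (dot x e1) (dot x e2) => [p1 p2] [q1 q2] x0.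
  have N0 : N p1 p2 q1 q2 != 0.
    have := dot_gt0 dot x0; rewrite dot_orthonormal ltcE => /andP[_].
    rewrite /= => N_gt0; rewrite gt_eqF//; apply: (lt_le_trans N_gt0).
    by rewrite le_eqVlt; apply/orP; left; apply/eqP; rewrite /N; ring.
  rewrite hopf//; eexists; last by [].
  do 3 eexists; split; last by [].
  by move: N0; rewrite /N => N0; field.
have s1 : s ^+ 2 <= 1 by rewrite -suv -addrA lerDl addr_ge0 ?sqr_ge0.
suff [p1 [p2 [q1 [q2 [N1 sE uE vE]]]]] : exists p1 p2 q1 q2,
    [/\ N p1 p2 q1 q2 = 1, s = p1 ^+ 2 + p2 ^+ 2 - q1 ^+ 2 - q2 ^+ 2,
        u = 2 * (p1 * q1 + p2 * q2) & v = 2 * (p1 * q2 - p2 * q1)].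
  exists ((p1 +i* p2)%C *: e1 + (q1 +i* q2)%C *: e2).
  eexists; split; [by [] | | by rewrite hopf N1 ?oner_neq0// !divr1 -sE -uE -vE].
  apply: contra_eq_neq N1 => x0; have := dot0l dot 0.
  rewrite -x0 dot_orthonormal => /(congr1 (@complex.Re R)) /= N0.
  rewrite (_ : N _ _ _ _ = 0) 1?eq_sym ?oner_neq0// -[RHS]N0 /N; ring.
have [s0|s0] := ltP 0 (1 + s); last first.
  (* The fibre of the south pole is spanned by e2; elsewhere the first
     coordinate of x can be taken real and positive. *)
  have sE : s = -1 by move: s1 s0; nra.
  have := suv; rewrite sE sqrrN expr1n => uv.
  have u0 : u = 0.
    by apply/eqP; rewrite -sqrf_eq0; move: (sqr_ge0 u) (sqr_ge0 v); lra.
  have v0 : v = 0.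
    by apply/eqP; rewrite -sqrf_eq0; move: (sqr_ge0 u) (sqr_ge0 v); lra.
  by exists 0, 0, 1, 0; rewrite u0 v0 /N; split; ring.
pose c := Num.sqrt ((1 + s) / 2).
have cE : c ^+ 2 = (1 + s) / 2 by rewrite sqr_sqrtr// divr_ge0// ltW.
have c0 : c != 0 by rewrite -sqrf_eq0 cE mulf_neq0 ?invr_eq0 ?pnatr_eq0 ?gt_eqF.
have sE : s = 2 * c ^+ 2 - 1 by rewrite cE; field.
have uvE : (u / (2 * c)) ^+ 2 + (v / (2 * c)) ^+ 2 = 1 - c ^+ 2.
  apply: (mulfI (_ : 4 * c ^+ 2 != 0));
    first by rewrite mulf_neq0 ?expf_neq0 ?pnatr_eq0.
  transitivity (u ^+ 2 + v ^+ 2); first by field.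
  by move: suv; rewrite sE => suv; lra.
exists c, 0, (u / (2 * c)), (v / (2 * c)); split.
- by rewrite /N expr0n addr0 -addrA uvE; ring.
- by rewrite sE expr0n addr0 -addrA -opprD uvE; ring.
- by field.
- by field.
Qed.

End RangeFromSphere.

Lemma DW_BCK_pCK (R : realType) (V : vectType R[i]) (dot : {dot V for Num.conj})
    (A : 'End(V)) :
  DW_BCK dot A = [set bck_of_pck p | p in DW_pCK dot A].
Proof.
have bckE (x : V) : x != 0 ->
    (2 * complex.Re (dot (A x) x) /
       (complex.Re (dot (A x) (A x)) + complex.Re (dot x x)),
     (complex.Re (dot (A x) (A x)) - complex.Re (dot x x)) /
       (complex.Re (dot (A x) (A x)) + complex.Re (dot x x))) =
    bck_of_pck (Some (complex.Re (dot (A x) x) / complex.Re (dot x x),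
                      complex.Re (dot (A x) (A x)) / complex.Re (dot x x))).
  move=> x0; have := dot_gt0 dot x0; rewrite ltcE => /andP[_ /= xx0].
  have yy0 : 0 <= complex.Re (dot (A x) (A x)).
    have [->|Ax0] := eqVneq (A x) 0; first by rewrite dot0l.
    by have := dot_gt0 dot Ax0; rewrite ltcE => /andP[_ /= /ltW].
  move: (complex.Re _) (complex.Re _) (complex.Re _) xx0 yy0 => m y n n0 y0.
  have n0' : n != 0 by rewrite gt_eqF.
  have yn0 : y + n != 0 by rewrite gt_eqF// ltr_wpDl.
  by rewrite /=; congr (_, _); field; rewrite ?n0' ?yn0.
apply/seteqP; split=> [p [x [_ [-> x0 ->]]] | _ [_ [x [_ [-> x0 ->]]] <-]].
  by rewrite bckE//; eexists; last by []; exists x, (A x).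
by exists x, (A x); split => //; rewrite bckE.
Qed.

(** * Change of model *)

Section Models.
Variable R : realType.

Lemma sqmodcE (l : R[i]) :
  sqmodc l = complex.Re l ^+ 2 + complex.Im l ^+ 2.
Proof. by rewrite /sqmodc -add_Re2_Im2. Qed.

Lemma bck_of_pck_sqnorm (x z : R) : z + 1 != 0 ->
  1 - sqnorm (bck_of_pck (Some (x, z))) = 4 * (z - x ^+ 2) / (z + 1) ^+ 2.
Proof. by move=> z1; rewrite /sqnorm /dotp /=; field. Qed.

Lemma sqnorm_bck_of_pck_le1 (p : option (R * R)) :
  carrier R pCK p -> sqnorm (bck_of_pck p) <= 1.
Proof.
case: p => [[x z] /= xz|_]; last by rewrite /sqnorm /dotp /= mul0r add0r mulr1.
have z0 : 0 <= z by apply: le_trans xz; rewrite sqr_ge0.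
have z1 : 0 < z + 1 by rewrite ltr_wpDl.
rewrite -subr_ge0 bck_of_pck_sqnorm ?gt_eqF// divr_ge0 ?sqr_ge0//.
by rewrite mulr_ge0// subr_ge0.
Qed.

Lemma iota2_pCK_carrier (l : R[i]) : carrier R pCK (iota2 pCK l).
Proof. by rewrite /= sqmodcE lerDl sqr_ge0. Qed.

Lemma iota2_BCK_le1 (l : R[i]) : sqnorm (iota2 BCK l) <= 1.
Proof. exact: (sqnorm_bck_of_pck_le1 (iota2_pCK_carrier l)). Qed.

Lemma ph_of_bck_iota2 (l : R[i]) : ph_of_bck (iota2 BCK l) = iota2 Ph l.
Proof.
have n0 : 0 < sqmodc l + 1.
  by rewrite sqmodcE ltr_wpDl ?addr_ge0 ?sqr_ge0.
have n0' : sqmodc l + 1 != 0 by rewrite gt_eqF.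
have zE : 1 - (sqmodc l - 1) / (sqmodc l + 1) = 2 / (sqmodc l + 1) by field.
have z0 : 1 - (sqmodc l - 1) / (sqmodc l + 1) != 0.
  by rewrite zE mulf_neq0 ?invr_eq0 ?pnatr_eq0.
rewrite /ph_of_bck [X in if X then _ else _](_ : _ = false); last first.
  by apply: contraNF z0 => /= /eqP->; rewrite subrr.
rewrite (bck_of_pck_sqnorm (complex.Re l)) //= zE; congr (Some (_, _)).
  by field.
have -> : 4 * (sqmodc l - complex.Re l ^+ 2) / (sqmodc l + 1) ^+ 2 =
          (complex.Im l * (2 / (sqmodc l + 1))) ^+ 2.
  by rewrite {1}sqmodcE; field.
rewrite sqrtr_sqr normrM [`|2 / _|]gtr0_norm ?divr_gt0//.
by rewrite mulfK// mulf_neq0 ?invr_eq0 ?pnatr_eq0.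
Qed.

Lemma canonical_iota2 M (l : R[i]) : Defs.canonical (iota2 M l) (iota2 BCK l).
Proof.
case: M => /=; split; rewrite ?ph_of_bck_iota2//.
- exact: iota2_BCK_le1.
- exact: iota2_pCK_carrier.
- exact: iota2_BCK_le1.
Qed.

Lemma sqnorm_le1_snd (v : R * R) : sqnorm v <= 1 -> v.2 <= 1.
Proof. case: v => x z; rewrite /sqnorm /dotp /= => ?; nra. Qed.

Lemma sqnorm_le1_top (v : R * R) : sqnorm v <= 1 -> v.2 = 1 -> v = (0, 1).
Proof.
case: v => x z; rewrite /sqnorm /dotp /= => + z1; rewrite z1 => ?.
by congr (_, _); apply/eqP; rewrite -sqrf_eq0; apply/eqP; nra.
Qed.

(** In Ph, the squared Euclidean length is (1 + z) / (1 - z), from which z can be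
    recovered. *)
Lemma ph_of_bck_inj (v w : R * R) : sqnorm v <= 1 -> sqnorm w <= 1 ->
  ph_of_bck v = ph_of_bck w -> v = w.
Proof.
move=> v1 w1; rewrite /ph_of_bck.
case: eqP => [/(sqnorm_le1_top v1)->|/eqP v2];
  case: eqP => [/(sqnorm_le1_top w1)->|/eqP w2] //.
have {v2} : 1 - v.2 != 0 by rewrite subr_eq0 eq_sym.
have {w2} : 1 - w.2 != 0 by rewrite subr_eq0 eq_sym.
case: v w v1 w1 => [x z] [x' z'] /= v1 w1 w2 v2 [xE yE].
have : (x / (1 - z)) ^+ 2 + (Num.sqrt (1 - sqnorm (x, z)) / (1 - z)) ^+ 2 =
   (x' / (1 - z')) ^+ 2 + (Num.sqrt (1 - sqnorm (x', z')) / (1 - z')) ^+ 2.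
  by rewrite xE yE.
rewrite ![(Num.sqrt _ / _) ^+ 2]exprMn !sqr_sqrtr ?subr_ge0//.
rewrite (_ : _ + _ = (1 + z) / (1 - z)); last by rewrite /sqnorm /dotp /=; field.
rewrite (_ : (x' / _) ^+ 2 + _ = (1 + z') / (1 - z'));
  last by rewrite /sqnorm /dotp /=; field.
move=> /eqP; rewrite eqr_div// => /eqP zz.
have zE : z = z' by lra.
move: xE; rewrite zE in v2 *; move=> /(congr1 (fun y => y * (1 - z'))).
by rewrite !mulfVK// => ->.
Qed.

Variables (V : vectType R[i]) (dot : {dot V for Num.conj}) (A : 'End(V)).
Hypothesis sub : DW_pCK dot A `<=` carrier R pCK.

Lemma DW_BCK_le1 (v : R * R) : DW_BCK dot A v -> sqnorm v <= 1.
Proof.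
by rewrite DW_BCK_pCK => -[p pD <-]; apply: sqnorm_bck_of_pck_le1; exact: sub.
Qed.

Lemma DW_sub_carrier M : DW dot M A `<=` carrier R M.
Proof.
case: M => //= [v|_ [v /DW_BCK_le1 v1 <-]]; first exact: DW_BCK_le1.
rewrite /ph_of_bck; case: ifP => //= _.
by rewrite divr_ge0 ?sqrtr_ge0// subr_ge0 sqnorm_le1_snd.
Qed.

Lemma to_bck_DW M : to_bck (DW dot M A) = DW_BCK dot A.
Proof.
case: M; apply/seteqP; split=> v; rewrite /to_bck /=.
- by move=> [p pD [_ ->]].
- by move=> vD; exists v => //; split => //; exact: DW_BCK_le1.
- by rewrite DW_BCK_pCK => -[p pD [_ ->]]; exists p.
- by rewrite DW_BCK_pCK => -[p pD <-]; exists p => //; split => //; exact: sub.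
- move=> [_ [w wD <-] [v1 wv]].
  by rewrite -(ph_of_bck_inj (DW_BCK_le1 wD) v1 wv).
- move=> vD; exists (ph_of_bck v); first by exists v.
  by split => //; exact: DW_BCK_le1.
Qed.

Lemma DW_transport0 (N : set (R * R) -> Prop) M :
  N (DW_BCK dot A) -> transport0 N (DW dot M A).
Proof. by split; rewrite ?to_bck_DW//; exact: DW_sub_carrier. Qed.

Lemma DW_transport1 (N : R * R -> set (R * R) -> Prop) M l :
  N (iota2 BCK l) (DW_BCK dot A) -> transport1 N (iota2 M l) (DW dot M A).
Proof.
move=> Nl; split; first exact: DW_sub_carrier.
by exists (iota2 BCK l); rewrite ?to_bck_DW//; exact: canonical_iota2.
Qed.

Lemma DW_transport2 (N : R * R -> R * R -> set (R * R) -> Prop) M l1 l2 :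
  N (iota2 BCK l1) (iota2 BCK l2) (DW_BCK dot A) ->
  transport2 N (iota2 M l1) (iota2 M l2) (DW dot M A).
Proof.
move=> Nl; split; first exact: DW_sub_carrier.
exists (iota2 BCK l1), (iota2 BCK l2).
by rewrite to_bck_DW; split => //; exact: canonical_iota2.
Qed.

Lemma DW_singleton M l :
  DW_pCK dot A = [set iota2 pCK l] -> DW dot M A = [set iota2 M l].
Proof.
move=> D; have DB : DW_BCK dot A = [set iota2 BCK l].
  by rewrite DW_BCK_pCK D image_set1.
by case: M => //=; rewrite DB image_set1 ph_of_bck_iota2.
Qed.

End Models.

(** * Quadratic inequalities in the plane *)

Section Quadrics.
Variable R : realType.

Definition quadric (a b c d e f : R) (v : R * R) : R :=
  a * v.1 ^+ 2 + 2 * b * v.1 * v.2 + c * v.2 ^+ 2 + 2 * d * v.1 + 2 * e * v.2 + f.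

Definition posdef (a b c : R) : Prop :=
  forall x z, (x != 0) || (z != 0) -> 0 < a * x ^+ 2 + 2 * b * x * z + c * z ^+ 2.

Lemma posdef_det (a b c : R) : posdef a b c -> 0 < a /\ 0 < a * c - b ^+ 2.
Proof.
move=> pd; have a0 : 0 < a.
  by have := pd 1 0; rewrite oner_eq0 => /(_ isT); lra.
split=> //; have := pd b (- a); rewrite oppr_eq0 (gt_eqF a0) orbT => /(_ isT).
rewrite (_ : _ + _ = a * (a * c - b ^+ 2)); last by ring.
by rewrite pmulr_rgt0.
Qed.

(** Principal axes.  For b <> 0 let l be the larger eigenvalue of the matrix with
    rows (a, b), (b, c); then (b, l - a) is an eigenvector, and (l - a)(l - c) =
    b^2 expresses a and c through l, b and k = l - a. *)
Lemma posdef_diag (a b c : R) : posdef a b c ->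
  exists (u : R * R) (l m : R), [/\ sqnorm u = 1, 0 < l, 0 < m &
    forall x z, a * x ^+ 2 + 2 * b * x * z + c * z ^+ 2 =
      l * dotp (x, z) u ^+ 2 + m * dotp (x, z) (- u.2, u.1) ^+ 2].
Proof.
move=> pd.
suff [u [l [m [u1 E]]]] : exists (u : R * R) (l m : R), sqnorm u = 1 /\
    forall x z, a * x ^+ 2 + 2 * b * x * z + c * z ^+ 2 =
      l * dotp (x, z) u ^+ 2 + m * dotp (x, z) (- u.2, u.1) ^+ 2.
  have u0 : (u.1 != 0) || (u.2 != 0).
    apply: contraPT u1; rewrite negb_or !negbK => /andP[/eqP p0 /eqP q0].
    by rewrite /sqnorm /dotp p0 q0 !mul0r addr0 => /esym/eqP; rewrite oner_eq0.
  exists u, l, m; split => //.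
    have := pd _ _ u0; rewrite E.
    rewrite (_ : dotp (u.1, u.2) u = 1); last by rewrite -u1.
    rewrite (_ : dotp (u.1, u.2) _ = 0); last by rewrite /dotp /=; ring.
    by rewrite expr1n mulr1 expr0n mulr0 addr0.
  have := pd (- u.2) u.1; rewrite oppr_eq0 orbC => /(_ u0); rewrite E.
  rewrite (_ : dotp (- u.2, u.1) (- u.2, u.1) = 1); last first.
    by rewrite -u1 /sqnorm /dotp /= mulrNN addrC.
  rewrite (_ : dotp _ u = 0); last by rewrite /dotp /=; ring.
  by rewrite expr1n mulr1 expr0n mulr0 add0r.
have [b0|b0] := eqVneq b 0.
  exists (1, 0), a, c; split; first by rewrite /sqnorm /dotp /= mulr0 mulr1 addr0.
  by move=> x z; rewrite b0 /dotp /=; ring.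
pose l := (a + c + Num.sqrt ((a - c) ^+ 2 + 4 * b ^+ 2)) / 2.
have lE : (l - a) * (l - c) = b ^+ 2.
  have : Num.sqrt ((a - c) ^+ 2 + 4 * b ^+ 2) ^+ 2 = (a - c) ^+ 2 + 4 * b ^+ 2.
    by rewrite sqr_sqrtr//; move: (sqr_ge0 (a - c)) (sqr_ge0 b); lra.
  by rewrite /l; move: (Num.sqrt _) => h; lra.
pose k := l - a.
have k0 : k != 0.
  by apply: contra_neq b0 => k0; apply/eqP; rewrite -sqrf_eq0 -lE -/k k0 mul0r.
have aE : a = l - k by rewrite /k; ring.
have cE : c = l - b ^+ 2 / k by rewrite -lE -/k; field.
have n0 : 0 < b ^+ 2 + k ^+ 2.
  by rewrite ltr_wpDl ?sqr_ge0// exprn_even_gt0.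
pose n := Num.sqrt (b ^+ 2 + k ^+ 2).
have nE : n ^+ 2 = b ^+ 2 + k ^+ 2 by rewrite sqr_sqrtr// ltW.
have n1 : n != 0 by rewrite -sqrf_eq0 nE gt_eqF.
have nE' : b ^+ 2 + k ^+ 2 != 0 by rewrite gt_eqF.
exists (b / n, k / n), l, (l - k - b ^+ 2 / k); split.
  by rewrite /sqnorm /dotp /= -!expr2 !expr_div_n nE; field.
move=> x z; rewrite aE cE /dotp /=.
have -> : x * (b / n) + z * (k / n) = (x * b + z * k) / n by field.
have -> : x * - (k / n) + z * (b / n) = (z * b - x * k) / n by field.
rewrite !expr_div_n nE; field.
by rewrite k0 nE'.
Qed.

(** About the centre, where the gradient vanishes, the polynomial is a positive
    definite form minus a constant h, and h > 0 because there is a negative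
    value. *)
Lemma elliptical_disk_quadric (a b c d e f : R) (v0 : R * R) :
  posdef a b c -> quadric a b c d e f v0 < 0 ->
  is_elliptical_disk [set v | quadric a b c d e f v <= 0].
Proof.
move=> pd q0; have [a0 D0] := posdef_det pd.
have D1 : a * c - b ^+ 2 != 0 by rewrite gt_eqF.
pose cx := (b * e - c * d) / (a * c - b ^+ 2).
pose cz := (b * d - a * e) / (a * c - b ^+ 2).
pose h := - quadric a b c d e f (cx, cz).
have qE x z : quadric a b c d e f (x, z) =
   a * (x - cx) ^+ 2 + 2 * b * (x - cx) * (z - cz) + c * (z - cz) ^+ 2 - h.
  by rewrite /h /quadric /cx /cz /=; field.
have [u [l [m [u1 l0 m0 E]]]] := posdef_diag pd.
have h0 : 0 < h.
  move: q0; case: v0 => x z; rewrite qE E subr_lt0; apply: le_lt_trans.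
  by rewrite addr_ge0// mulr_ge0 ?sqr_ge0 ?ltW.
have hl := ltW (divr_gt0 h0 l0); have hm := ltW (divr_gt0 h0 m0).
exists (cx, cz), u, (Num.sqrt (h / l)), (Num.sqrt (h / m)).
split; rewrite ?sqrtr_gt0 ?divr_gt0//.
apply/seteqP; split=> -[x z]; rewrite /elliptical_disk /=;
  rewrite -[(x, z) - (cx, cz)]/(x - cx, z - cz) qE E !expr_div_n !sqr_sqrtr//;
  set p := dotp _ _ ^+ 2; set q := dotp _ _ ^+ 2;
  rewrite (_ : p / (h / l) + q / (h / m) = (l * p + m * q) / h)
    ?subr_le0 ?ler_pdivrMr ?mul1r//;
  by field; rewrite !gt_eqF.
Qed.

Lemma quadratic_factor (a b c : R) (t0 : R) :
  0 < a -> a * t0 ^+ 2 + 2 * b * t0 + c <= 0 ->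
  exists x y, x <= y /\ forall t, a * t ^+ 2 + 2 * b * t + c = a * ((t - x) * (t - y)).
Proof.
move=> a0 q0; have D0 : 0 <= b ^+ 2 - a * c.
  rewrite (_ : _ - _ = (a * t0 + b) ^+ 2 - a * (a * t0 ^+ 2 + 2 * b * t0 + c));
    last by ring.
  by rewrite subr_ge0 (le_trans _ (sqr_ge0 _))// mulr_ge0_le0// ltW.
pose h := Num.sqrt (b ^+ 2 - a * c).
have hE : h ^+ 2 = b ^+ 2 - a * c by rewrite sqr_sqrtr.
have a0' : a != 0 by rewrite gt_eqF.
exists ((- b - h) / a), ((- b + h) / a); split.
  by rewrite ler_pM2r ?invr_gt0// lerD2l (le_trans _ (sqrtr_ge0 _))//
    oppr_le0 sqrtr_ge0.
move=> t.
have -> : c = (b ^+ 2 - h ^+ 2) / a by rewrite hE; field.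
by field.
Qed.

Lemma factored_le0 (a x y t : R) : 0 < a -> x <= y ->
  (a * ((t - x) * (t - y)) <= 0) = (x <= t <= y).
Proof.
move=> a0 xy; rewrite pmulr_rle0//; apply/idP/andP => [H|[xt ty]].
  by split; nra.
by rewrite mulr_ge0_le0 ?subr_ge0// subr_le0.
Qed.

(** The two polynomials have the same roots. *)
Lemma same_sublevel_proportional1 (a b c a' b' c' : R) :
  0 < a -> 0 < a' -> c <= 0 ->
  (forall t, (a * t ^+ 2 + 2 * b * t + c <= 0) =
             (a' * t ^+ 2 + 2 * b' * t + c' <= 0)) ->
  a' * (a + 2 * b + c) = a * (a' + 2 * b' + c') /\ a' * c = a * c'.
Proof.
move=> a0 a'0 c0 E.
have q0 : a * 0 ^+ 2 + 2 * b * 0 + c <= 0 by rewrite expr0n !mulr0 !add0r.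
have [x [y [xy F]]] := quadratic_factor a0 q0.
have [x' [y' [xy' F']]] : exists x y, x <= y /\
  forall t, a' * t ^+ 2 + 2 * b' * t + c' = a' * ((t - x) * (t - y)).
  by apply: (@quadratic_factor a' b' c' 0); rewrite // -E.
have {}E t : (x <= t <= y) = (x' <= t <= y').
  by rewrite -(factored_le0 _ a0 xy) -(factored_le0 _ a'0 xy') -F -F' E.
have xE : x = x'.
  have := E x; have := E x'; rewrite !lexx xy xy' /=.
  by move=> /andP[? _] /esym/andP[? _]; apply/eqP; rewrite eq_le; apply/andP.
have yE : y = y'.
  have := E y; have := E y'; rewrite !lexx xy xy' !andbT.
  by move=> /andP[_ ?] /esym/andP[_ ?]; apply/eqP; rewrite eq_le; apply/andP.
split.
  have := F 1; have := F' 1; rewrite !expr1n !mulr1 xE yE => -> ->; ring.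
have := F 0; have := F' 0; rewrite !expr0n !mulr0 !add0r xE yE => -> ->; ring.
Qed.

(** On each line through v0 the two polynomials have the same roots, so they are
    proportional there; the factor is their ratio at v0, hence common to all the
    lines. *)
Lemma same_sublevel_proportional (a b c d e f a' b' c' d' e' f' : R) (v0 : R * R) :
  posdef a b c -> posdef a' b' c' -> quadric a b c d e f v0 < 0 ->
  [set v | quadric a b c d e f v <= 0] = [set v | quadric a' b' c' d' e' f' v <= 0] ->
  exists k k', [/\ 0 < k, 0 < k' &
    forall v, k * quadric a' b' c' d' e' f' v = k' * quadric a b c d e f v].
Proof.
move=> pd pd' q0 S.
set q := quadric a b c d e f; set q' := quadric a' b' c' d' e' f'.
have q'0 : q' v0 <= 0.
  have : [set v | q v <= 0] v0 by exact: ltW.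
  by rewrite S.
suff key v : q v0 * q' v = q' v0 * q v.
  exists (- q v0), (- q' v0); rewrite !oppr_gt0; split => // [|v]; last first.
    by rewrite !mulNr key.
  rewrite lt_neqAle q'0 andbT; apply/negP => /eqP q'00.
  have q'z v : q' v = 0.
    by apply/eqP; have /eqP := key v; rewrite q'00 mul0r mulf_eq0 (lt_eqF q0).
  (* The second difference of q' is twice its first coefficient. *)
  have [a'0 _] := posdef_det pd'.
  have : q' (1, 0) + q' (-1, 0) - 2 * q' (0, 0) = 2 * a'.
    by rewrite /q' /quadric /=; ring.
  by rewrite !q'z mulr0 addr0 subrr; move: a'0; lra.
pose x := v.1 - v0.1; pose z := v.2 - v0.2.
have [/andP[/eqP x0 /eqP z0]|xz] := boolP ((x == 0) && (z == 0)).
  suff -> : v = v0 by rewrite mulrC.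
  by rewrite [LHS]surjective_pairing [RHS]surjective_pairing
    (subr0_eq x0) (subr0_eq z0).
rewrite negb_and in xz.
pose g (a b c d e : R) := a * v0.1 * x + b * (v0.1 * z + v0.2 * x)
  + c * v0.2 * z + d * x + e * z.
have lineE t : q (v0.1 + t * x, v0.2 + t * z) =
    (a * x ^+ 2 + 2 * b * x * z + c * z ^+ 2) * t ^+ 2 + 2 * g a b c d e * t + q v0.
  by rewrite /q /quadric /g /=; ring.
have lineE' t : q' (v0.1 + t * x, v0.2 + t * z) =
    (a' * x ^+ 2 + 2 * b' * x * z + c' * z ^+ 2) * t ^+ 2
      + 2 * g a' b' c' d' e' * t + q' v0.
  by rewrite /q' /quadric /g /=; ring.
have [|E1 E0] := same_sublevel_proportional1 (pd _ _ xz) (pd' _ _ xz) (ltW q0)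
  (b := g a b c d e)
   (b' := g a' b' c' d' e') (c' := q' v0).
  move=> t; rewrite -lineE -lineE'.
  have := congr1 (fun T => T (v0.1 + t * x, v0.2 + t * z)) S => /= H.
  by apply/idP/idP => ?; [rewrite -H | rewrite H].
have vE : v = (v0.1 + 1 * x, v0.2 + 1 * z).
  by rewrite /x /z !mul1r ![_ + (_ - _)]addrC !subrK -surjective_pairing.
have := lineE 1; have := lineE' 1; rewrite -vE expr1n !mulr1 => -> ->.
have A0 := pd _ _ xz; move: E1 E0; rewrite -/q.
set B := a * _ + _ + _ in A0 *; set B' := a' * _ + _ + _.
set G := B + _ + _; set G' := B' + _ + _ => E1 E0.
apply: (mulfI (negbT (gt_eqF A0))).
by rewrite mulrCA -E1 mulrA [q v0 * B']mulrC E0 mulrA.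
Qed.

End Quadrics.

Section QuadricTopology.
Variable R : realType.
Import numFieldNormedType.Exports.

Lemma quadric_continuous (a b c d e f : R) : continuous (quadric a b c d e f).
Proof.
move=> v; have fst_v : (fst : R * R -> R) @ v --> v.1 by exact: cvg_fst.
have snd_v : (snd : R * R -> R) @ v --> v.2 by exact: cvg_snd.
have k (r : R) : (fun _ : R * R => r) @ v --> r by exact: cvg_cst.
rewrite /quadric.
apply: cvgD; last exact: k.
apply: cvgD; last by apply: cvgM => //; apply: k.
apply: cvgD; last by apply: cvgM => //; apply: k.
apply: cvgD; last by apply: cvgM; [exact: k | rewrite expr2; apply: cvgM].
apply: cvgD; last by apply: cvgM => //; apply: cvgM => //; apply: k.
by apply: cvgM; [exact: k | rewrite expr2; apply: cvgM].
Qed.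

Lemma quadric_interior (a b c d e f : R) (v : R * R) :
  quadric a b c d e f v < 0 ->
  interior [set v | quadric a b c d e f v <= 0] v.
Proof.
move=> q0; have : \forall w \near v, quadric a b c d e f w < 0.
  exact: (cvgr_lt _ (@quadric_continuous a b c d e f v) _ q0).
by apply: filterS => w /= /ltW.
Qed.

End QuadricTopology.

(** * Squares in the pencil of the range and the absolute *)

Section RangeQuadric.
Variable R : realType.

(** The coefficients are recovered from the values of the polynomial at small
    integer points. *)
Lemma range_form_quadric (a1 b1 a2 b2 t : R) : t != 0 ->
  exists a b c d e f, posdef a b c /\
    forall v, range_form a1 b1 a2 b2 t (1 - v.2) v.1 (1 + v.2) =
              quadric a b c d e f v.
Proof.
move=> t0; set r := range_form a1 b1 a2 b2 t.
exists (r 0 1 0), ((r (-1) 1 1 - r 0 1 0 - r (-1) 0 1) / 2), (r (-1) 0 1).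
exists ((r 1 1 1 - r 1 (-1) 1) / 4), ((r 0 0 2 - r 2 0 0) / 4), (r 1 0 1).
split=> [x z xz|v].
  have := range_form_posdef a1 b1 a2 b2 t0 xz; rewrite -/r; congr (0 < _).
  by rewrite /r /range_form /line_form /polar_form; field.
by rewrite /quadric /r /range_form /line_form /polar_form; field.
Qed.

(** In the situation of [range_form_square_pencil0], with B1 = b1^2, B2 = b2^2 and
    T = t^2, the numbers zz, ..., ww are the entries of a symmetric matrix of rank
    one, and the hypotheses are three of its minors.  If a <> 0, elimination of k
    from the first two gives (g - a^2)(4 B2 (a^2 + T) + (g + T)^2) = 0.  The first
    factor is B1 - B2; the second one vanishes only if B2 = 0 and g = - T, which
    contradicts g = a^2 + B1.  If B1 = B2, the third minor gives B1 = 0.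
    If a = 0, the second minor gives k = g^2 and then the third one g = 0. *)
Lemma rank_one_minors (a B1 B2 T k : R) : 0 < T -> 0 <= B1 -> 0 <= B2 ->
  let g := a ^+ 2 + B1 - B2 in
  let zz := a ^+ 2 + T in
  let xz := - a * (g + T) in
  let xx := g ^+ 2 - k in
  let wx := a * B2 * (g - T) in
  let wz := - a ^+ 2 * B2 + T * (a ^+ 2 + B1 + B2) / 2 + k / 2 in
  let ww := B2 ^+ 2 * a ^+ 2 + T * (a ^+ 2 + B1) * B2 in
  zz * wx = xz * wz -> zz * xx = xz ^+ 2 -> zz * ww = wz ^+ 2 ->
  B1 = B2 /\ (a = 0 \/ B1 = 0).
Proof.
move=> T0 B10 B20 g zz xz xx wx wz ww M1 M2 M3.
have [a0|a0] := eqVneq a 0.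
  split; last by left.
  have kE : k = g ^+ 2.
    have : T * (g ^+ 2 - k) = 0.
      by move: M2; rewrite /zz /xx /xz a0 => M2; lra.
    by move/eqP; rewrite mulf_eq0 (gt_eqF T0) subr_eq0 => /eqP->.
  have gE : g = B1 - B2 by rewrite /g a0 expr0n add0r.
  have : g ^+ 2 * (T ^+ 2 + 2 * T * (B1 + B2) + g ^+ 2) = 0.
    by move: M3; rewrite /zz /ww /wz a0 kE gE => M3; lra.
  move/eqP; rewrite mulf_eq0 => /orP[|].
    by rewrite sqrf_eq0 gE subr_eq0 => /eqP.
  rewrite gt_eqF// ltr_pwDl ?sqr_ge0// ltr_pwDl ?exprn_gt0//.
  by rewrite !mulr_ge0 ?addr_ge0// ltW.
have a2 : 0 < a ^+ 2 by rewrite exprn_even_gt0.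
have E1 : 4 * B2 * T * (g - a ^+ 2) = - (g + T) * (T * g + k).
  apply: (mulfI a0); move: M1; rewrite /zz /wx /xz /wz /g => M1; lra.
have E2 : (a ^+ 2 + T) * k = T * (g ^+ 2 - 2 * a ^+ 2 * g - a ^+ 2 * T).
  by move: M2; rewrite /zz /xx /xz => M2; lra.
have : T * ((g - a ^+ 2) * (4 * B2 * (a ^+ 2 + T) + (g + T) ^+ 2)) = 0.
  transitivity ((a ^+ 2 + T) * (4 * B2 * T * (g - a ^+ 2))
    + (g + T) * (T * g * (a ^+ 2 + T)
                 + T * (g ^+ 2 - 2 * a ^+ 2 * g - a ^+ 2 * T)));
    first by ring.
  by rewrite E1 -E2; ring.
move/eqP; rewrite !mulf_eq0 (gt_eqF T0) /= => /orP[/eqP ga|]; last first.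
  have B2T : 0 <= 4 * B2 * (a ^+ 2 + T) by rewrite !mulr_ge0// addr_ge0// ltW.
  rewrite paddr_eq0 ?sqr_ge0// => /andP[/eqP B2E gT].
  have {}B2E : B2 = 0.
    move/eqP: B2E; rewrite mulf_eq0 (gt_eqF (addr_gt0 a2 T0)) orbF.
    by rewrite mulf_eq0 pnatr_eq0 => /eqP.
  have {}gT : g + T = 0 by apply/eqP; rewrite -sqrf_eq0.
  move: gT; rewrite /g B2E => gT.
  by move: gT a2 T0 B10; lra.
have BE : B1 = B2 by move: ga; rewrite /g; lra.
split=> //; right.
have kE : k = - a ^+ 2 * T.
  apply: (mulfI (negbT (gt_eqF (addr_gt0 a2 T0)))); rewrite E2.
  by rewrite (subr0_eq ga); ring.
have : B1 * (4 * a ^+ 2 * T * B1 + (a ^+ 2 + T) * T * a ^+ 2) = 0.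
  by move: M3; rewrite /zz /ww /wz kE -BE => M3; lra.
move/eqP; rewrite mulf_eq0 => /orP[/eqP//|].
have p1 : 0 <= 4 * a ^+ 2 * T * B1 by nra.
have p2 : 0 < (a ^+ 2 + T) * T * a ^+ 2.
  by apply: mulr_gt0 => //; apply: mulr_gt0 => //; apply: addr_gt0.
by rewrite gt_eqF// ltr_wpDl.
Qed.

(** Replacing A by A - a2 acts on the model by a parabolic isometry, which preserves
    z w - x^2. *)
Lemma range_form_shift (a1 b1 a2 b2 t w x z : R) :
  range_form a1 b1 a2 b2 t w (x + a2 * w) (z + 2 * a2 * x + a2 ^+ 2 * w) =
  range_form (a1 - a2) b1 0 b2 t w x z.
Proof. by rewrite /range_form /line_form /polar_form; ring. Qed.

(** The case a2 = 0.  The values at (0, 0, 1), (0, 1, 0), (1, 0, 0) and at their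
    sums in pairs determine the matrix of the quadratic form. *)
Lemma range_form_square_pencil0 (a b1 b2 t m p q r k : R) : t != 0 ->
  (forall w x z, range_form a b1 0 b2 t w x z =
     m * (p * w + q * x + r * z) ^+ 2 + k * (z * w - x ^+ 2)) ->
  b1 ^+ 2 = b2 ^+ 2 /\ (a = 0 \/ b1 ^+ 2 = 0).
Proof.
move=> t0 H; have T0 : 0 < t ^+ 2 by rewrite exprn_even_gt0.
pose K := - (k + t ^+ 2 * (2 * a ^+ 2 + 2 * b1 ^+ 2 + 2 * b2 ^+ 2 + t ^+ 2)).
move: H; rewrite /range_form /line_form /polar_form => H.
have Hzz := H 0 0 1; have Hxx := H 0 1 0; have Hww := H 1 0 0.
have Hxz := H 0 1 1; have Hwx := H 1 1 0; have Hwz := H 1 0 1.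
apply: (@rank_one_minors a (b1 ^+ 2) (b2 ^+ 2) (t ^+ 2) K); rewrite ?sqr_ge0//.
- transitivity ((m * r ^+ 2) * (m * p * q)).
    by congr (_ * _); rewrite /K; lra.
  by rewrite [RHS](_ : _ = (m * q * r) * (m * p * r));
    [ring | congr (_ * _); rewrite /K; lra].
- transitivity ((m * r ^+ 2) * (m * q ^+ 2)).
    by congr (_ * _); rewrite /K; lra.
  by rewrite [RHS](_ : _ = (m * q * r) ^+ 2); [ring | congr (_ ^+ _); rewrite /K; lra].
- transitivity ((m * r ^+ 2) * (m * p ^+ 2)).
    by congr (_ * _); rewrite /K; lra.
  by rewrite [RHS](_ : _ = (m * p * r) ^+ 2); [ring | congr (_ ^+ _); rewrite /K; lra].
Qed.

(** For |p| <= 1 the hypothesis says that the range has the same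
    equation, up to a factor, as a disk or horodisk about p.  It is an equality of
    quadratic forms in (w, x, z) on the plane w + z = 2; by homogeneity and the parallelogram law it holds
    everywhere. *)
Lemma range_form_square_pencil (a1 b1 a2 b2 t m k : R) (p : R * R) : t != 0 ->
  (forall v, range_form a1 b1 a2 b2 t (1 - v.2) v.1 (1 + v.2) =
     m * ((1 - dotp p v) ^+ 2 - k * (1 - sqnorm v))) ->
  b1 ^+ 2 = b2 ^+ 2 /\ (a1 = a2 \/ b1 ^+ 2 = 0).
Proof.
move=> t0 H.
pose L w x z := (1 + p.2) / 2 * w - p.1 * x + (1 - p.2) / 2 * z.
pose D w x z := range_form a1 b1 a2 b2 t w x z
                - (m * L w x z ^+ 2 - m * k * (z * w - x ^+ 2)).
have D2 w x z : w + z = 2 -> D w x z = 0.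
  move=> wz; have := H (x, z - 1); rewrite /=.
  have -> : 1 + (z - 1) = z by ring.
  have -> : 1 - (z - 1) = w by lra.
  rewrite /D => ->; rewrite /L /sqnorm /dotp /=.
  have -> : w = 2 - z by lra.
  by field.
have D1 w x z : w + z != 0 -> D w x z = 0.
  move=> wz; pose c := 2 / (w + z).
  have c0 : c != 0 by rewrite mulf_neq0 ?invr_eq0 ?pnatr_eq0.
  have := D2 (c * w) (c * x) (c * z).
  rewrite -mulrDr divfK// => /(_ erefl) DE.
  apply: (mulfI (expf_neq0 2 c0)); rewrite mulr0 -DE.
  by rewrite /D range_form_homogeneous /L; ring.
have D0 w x z : D w x z = 0.
  have [wz|] := eqVneq (w + z) 0; last exact: D1.
  have e1 : D 1 0 1 = 0 by apply: D2.
  have e2 : D (w + 1) x (z + 1) = 0.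
    by apply: D2; rewrite addrACA wz add0r.
  have e3 : D (w - 1) x (z - 1) = 0.
    by apply: D1; apply/eqP => e; move: wz e; lra.
  have : D (w + 1) x (z + 1) + D (w - 1) x (z - 1) = 2 * D w x z + 2 * D 1 0 1.
    by rewrite /D /L /range_form /line_form /polar_form; field.
  by rewrite e1 e2 e3; lra.
have [|b12 ab] := @range_form_square_pencil0 (a1 - a2) b1 b2 t m
   ((1 + p.2) / 2 - p.1 * a2 + (1 - p.2) / 2 * a2 ^+ 2)
   (- p.1 + (1 - p.2) * a2) ((1 - p.2) / 2) (- (m * k)) t0.
  move=> w x z; rewrite -range_form_shift.
  have := D0 w (x + a2 * w) (z + 2 * a2 * x + a2 ^+ 2 * w).
  by rewrite /D => /subr0_eq->; rewrite /L; field.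
by split => //; case: ab => [/subr0_eq|]; [left | right].
Qed.

End RangeQuadric.

(** * Equations of disks, horodisks and distance bands *)

Section HyperbolicForms.
Variable R : realType.

Lemma arcosh_arg_ge1 (x : R) : 1 <= x -> 1 <= x + Num.sqrt (x ^+ 2 - 1).
Proof. by move=> x1; rewrite (le_trans x1)// lerDl sqrtr_ge0. Qed.

Lemma le_arcosh (x y : R) : 1 <= x -> 1 <= y -> (arcosh x <= arcosh y) = (x <= y).
Proof.
move=> x1 y1; have x2 := arcosh_arg_ge1 x1; have y2 := arcosh_arg_ge1 y1.
rewrite /arcosh ler_ln ?posrE ?(lt_le_trans ltr01)//.
apply/idP/idP => [|xy].
  apply: contraTT; rewrite -!ltNge => yx; apply: ltr_leD => //.
  by rewrite ler_wsqrtr// lerD2r; nra.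
apply: lerD => //; rewrite ler_wsqrtr// lerD2r; nra.
Qed.

Lemma arcosh_gt0 (x : R) : 1 < x -> 0 < arcosh x.
Proof. by move=> x1; rewrite ln_gt0// ltr_wpDr ?sqrtr_ge0. Qed.

Lemma arcosh_surj (r : R) : 0 < r -> exists2 x, 1 < x & arcosh x = r.
Proof.
move=> r0; set e := expR r.
have e1 : 1 < e by rewrite expR_gt1.
have e0 : 0 < e by exact: expR_gt0.
have e0' : e != 0 by rewrite gt_eqF.
exists ((e + e^-1) / 2).
  rewrite -subr_gt0 (_ : _ - _ = (e - 1) ^+ 2 / (2 * e)); last by field.
  apply: divr_gt0; last by rewrite mulr_gt0.
  by rewrite exprn_even_gt0//= subr_eq0 gt_eqF.
rewrite /arcosh (_ : _ ^+ 2 - 1 = ((e - e^-1) / 2) ^+ 2); last by field.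
rewrite sqrtr_sqr ger0_norm; last first.
  by rewrite divr_ge0// subr_ge0 (le_trans _ (ltW e1))// invf_le1 ?ltW.
by rewrite (_ : _ + _ = e); [rewrite /e expRK | field].
Qed.

(** With |p| < 1 this is the inequality cosh d(p, v) <= cosh r, squared and cleared
    of denominators, for k = (cosh r)^2 (1 - |p|^2); with |p| = 1 it is, up to a
    factor, the equation of a horodisk. *)
Definition disk_form (p : R * R) (k : R) (v : R * R) : R :=
  (1 - dotp p v) ^+ 2 - k * (1 - sqnorm v).

Lemma dotp_cauchy_schwarz (v w : R * R) : dotp v w ^+ 2 <= sqnorm v * sqnorm w.
Proof.
rewrite -subr_ge0 (_ : _ - _ = (v.1 * w.2 - v.2 * w.1) ^+ 2) ?sqr_ge0//.
by rewrite /sqnorm /dotp; ring.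
Qed.

Lemma sqnorm_ge0 (v : R * R) : 0 <= sqnorm v.
Proof. by rewrite /sqnorm /dotp -!expr2 addr_ge0 ?sqr_ge0. Qed.

Lemma dotp_lt1 (v w : R * R) : sqnorm v < 1 -> sqnorm w <= 1 -> dotp v w < 1.
Proof.
move=> v1 w1; rewrite ltNge; apply/negP => vw.
have := dotp_cauchy_schwarz v w; have := sqnorm_ge0 v; have := sqnorm_ge0 w; nra.
Qed.

(** Put h = |v| |w|.  Then (1 - <v, w>)^2 >= (1 - h)^2, which is at least the
    left-hand side because 2 h <= |v|^2 + |w|^2. *)
Lemma reverse_cauchy_schwarz (v w : R * R) : sqnorm v < 1 -> sqnorm w < 1 ->
  (1 - sqnorm v) * (1 - sqnorm w) <= (1 - dotp v w) ^+ 2.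
Proof.
move=> v1 w1; have vw := dotp_lt1 v1 (ltW w1).
have := dotp_cauchy_schwarz v w; have := sqnorm_ge0 v; have := sqnorm_ge0 w.
move: (sqnorm v) (sqnorm w) (dotp v w) v1 w1 vw => x y d x1 y1 d1 x0 y0 dxy.
have xy0 : 0 <= x * y by exact: mulr_ge0.
have dh : d <= Num.sqrt (x * y).
  by rewrite (le_trans (ler_norm _))// -sqrtr_sqr ler_wsqrtr.
have hE : Num.sqrt (x * y) ^+ 2 = x * y by rewrite sqr_sqrtr.
have h1 : Num.sqrt (x * y) < 1.
  by rewrite -[X in _ < X]sqrtr1 ltr_sqrt// mulr_ilt1.
have h2 : 2 * Num.sqrt (x * y) <= x + y.
  have := sqr_ge0 (Num.sqrt x - Num.sqrt y).
  by rewrite sqrtrM// sqrrB !sqr_sqrtr//; lra.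
move: (Num.sqrt _) dh hE h1 h2 => h dh hE h1 h2.
have := mulr_ge0 (_ : 0 <= h - d) (_ : 0 <= 2 - h - d).
rewrite subr_ge0 => /(_ dh) H; have {}H : 0 <= (h - d) * (2 - h - d) by apply: H; lra.
by move: H hE h2; lra.
Qed.

Lemma disk_form_ordinary (p : R * R) (k : R) v : sqnorm p < 1 ->
  0 < k -> disk_form p k v <= 0 -> ordinary v.
Proof.
move=> p1 k0; rewrite /disk_form subr_le0 => H.
have v1 : sqnorm v <= 1.
  by rewrite -subr_ge0 -(pmulr_rge0 _ k0) (le_trans _ H)// sqr_ge0.
have pv := dotp_lt1 p1 v1.
rewrite /ordinary -subr_gt0 -(pmulr_rgt0 _ k0) (lt_le_trans _ H)//.
by rewrite exprn_even_gt0//= gt_eqF// subr_gt0.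
Qed.

(** The number c is cosh d(p, v); its comparisons with k are rid of square roots. *)
Lemma hdistE (p v : R * R) : ordinary p -> ordinary v ->
  exists2 c, 1 <= c & hdist p v = arcosh c /\
    forall k, 0 <= k ->
     (c <= k) = (disk_form p (k ^+ 2 * (1 - sqnorm p)) v <= 0) /\
     (k <= c) = (0 <= disk_form p (k ^+ 2 * (1 - sqnorm p)) v).
Proof.
move=> p1 v1.
have p0 : 0 < 1 - sqnorm p by rewrite subr_gt0.
have v0 : 0 < 1 - sqnorm v by rewrite subr_gt0.
have d0 : 0 < 1 - dotp p v by rewrite subr_gt0 dotp_lt1// ltW.
rewrite /hdist -(sqrtrM _ (ltW p0)); set h := Num.sqrt _.
have h0 : 0 < h by rewrite sqrtr_gt0 mulr_gt0.
have hE : h ^+ 2 = (1 - sqnorm p) * (1 - sqnorm v).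
  by rewrite sqr_sqrtr// mulr_ge0// ltW.
exists ((1 - dotp p v) / h).
  rewrite ler_pdivlMr// mul1r -(ler_pXn2r (_ : 0 < 2)%N) ?nnegrE ?(ltW h0) ?(ltW d0)//.
  by rewrite hE reverse_cauchy_schwarz.
split=> // k k0; have kh : 0 <= k * h by rewrite mulr_ge0// ltW.
rewrite ler_pdivrMr// ler_pdivlMr// /disk_form subr_le0 subr_ge0 -mulrA -hE -exprMn.
by rewrite !ler_pXn2r// ?nnegrE ?(ltW d0).
Qed.

Lemma hdist_le (p v : R * R) (k : R) : ordinary p -> ordinary v -> 1 <= k ->
  (hdist p v <= arcosh k) = (disk_form p (k ^+ 2 * (1 - sqnorm p)) v <= 0).
Proof.
move=> p1 v1 k1; have [c c1 [-> /(_ k (le_trans ler01 k1))[<- _]]] := hdistE p1 v1.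
exact: le_arcosh.
Qed.

Lemma le_hdist (p v : R * R) (k : R) : ordinary p -> ordinary v -> 1 <= k ->
  (arcosh k <= hdist p v) = (0 <= disk_form p (k ^+ 2 * (1 - sqnorm p)) v).
Proof.
move=> p1 v1 k1; have [c c1 [-> /(_ k (le_trans ler01 k1))[_ <-]]] := hdistE p1 v1.
exact: le_arcosh.
Qed.

Lemma hdiskP (S : set (R * R)) : hdisk S <->
  exists p k, [/\ ordinary p, 1 - sqnorm p < k & S = [set v | disk_form p k v <= 0]].
Proof.
split=> [[p [r [p1 /arcosh_surj[k k1 <-] ->]]] | [p [k [p1 pk ->]]]].
  have p0 : 0 < 1 - sqnorm p by rewrite subr_gt0.
  have k2 : 1 < k ^+ 2 by rewrite expr_gt1// (le_trans ler01 (ltW k1)).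
  exists p, (k ^+ 2 * (1 - sqnorm p)); split => //; first by rewrite ltr_pMl.
  apply/seteqP; split=> v /=; first by move=> [v1]; rewrite hdist_le// ltW.
  move=> F0; have v1 : ordinary v.
    by apply: disk_form_ordinary F0 => //; rewrite mulr_gt0// (lt_trans ltr01).
  by split=> //; rewrite hdist_le// ltW.
have p0 : 0 < 1 - sqnorm p by rewrite subr_gt0.
have k1 : 1 < Num.sqrt (k / (1 - sqnorm p)).
  have kp : 1 < k / (1 - sqnorm p) by rewrite ltr_pdivlMr ?mul1r.
  by rewrite -[X in X < _]sqrtr1 ltr_sqrt// (lt_trans ltr01).
have kE : Num.sqrt (k / (1 - sqnorm p)) ^+ 2 * (1 - sqnorm p) = k.
  by rewrite sqr_sqrtr ?divfK ?gt_eqF// divr_ge0// ltW// (lt_trans p0).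
exists p, (arcosh (Num.sqrt (k / (1 - sqnorm p)))); split; rewrite ?arcosh_gt0//.
apply/seteqP; split=> v /=; last by move=> [v1]; rewrite hdist_le ?kE// ltW.
move=> F0; have v1 : ordinary v.
  by apply: disk_form_ordinary F0 => //; rewrite (lt_trans p0).
by split=> //; rewrite hdist_le ?kE// ltW.
Qed.

Lemma ac_horodiskP (p : R * R) (S : set (R * R)) : ac_horodisk p S <->
  asymptotic p /\ exists2 k, 0 < k & S = [set v | disk_form p k v <= 0].
Proof.
have scale (c : R) v : 0 < c -> sqnorm v - 1 + c * (dotp v p - 1) ^+ 2 =
     c * disk_form p c^-1 v.
  by move=> c0; rewrite /disk_form /sqnorm /dotp; field; rewrite gt_eqF.
split=> -[p1 [c c0 ->]]; split=> //; exists c^-1; rewrite ?invr_gt0//;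
  apply/seteqP; split=> v /=; rewrite ?scale ?invr_gt0//
    ?invrK pmulr_rle0// ?invr_gt0//.
Qed.

Lemma disk_form_quadric (p : R * R) (k : R) : 0 < k ->
  exists a b c d e f, posdef a b c /\
    forall v, disk_form p k v = quadric a b c d e f v.
Proof.
move=> k0; exists (p.1 ^+ 2 + k), (p.1 * p.2), (p.2 ^+ 2 + k),
  (- p.1), (- p.2), (1 - k).
split=> [x z xz|v]; last by rewrite /disk_form /quadric /sqnorm /dotp; ring.
rewrite (_ : _ + _ = (p.1 * x + p.2 * z) ^+ 2 + k * (x ^+ 2 + z ^+ 2)); last by ring.
rewrite ltr_wpDl ?sqr_ge0// mulr_gt0//.
by rewrite lt_neqAle addr_ge0 ?sqr_ge0// andbT
  eq_sym paddr_eq0 ?sqr_ge0// !sqrf_eq0 negb_and.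
Qed.

End HyperbolicForms.

Section DistanceBand.
Variable R : realType.

Lemma asymptotic_dotp_lt1 (p q : R * R) :
  asymptotic p -> asymptotic q -> p <> q -> dotp p q < 1.
Proof.
move=> p1 q1 pq.
have E : (p.1 - q.1) ^+ 2 + (p.2 - q.2) ^+ 2 = 2 * (1 - dotp p q).
  have -> : 2 * (1 - dotp p q) = sqnorm p + sqnorm q - 2 * dotp p q.
    by rewrite p1 q1; ring.
  by rewrite /sqnorm /dotp; ring.
rewrite -subr_gt0 -(pmulr_rgt0 _ (ltr0Sn R 1)) -E lt_neqAle addr_ge0 ?sqr_ge0// andbT.
apply/eqP => /esym/eqP; rewrite paddr_eq0 ?sqr_ge0// !sqrf_eq0 !subr_eq0.
move=> /andP[/eqP p1E /eqP p2E]; apply: pq.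
by rewrite [p]surjective_pairing [q]surjective_pairing p1E p2E.
Qed.

Section Chord.
Variables p q : R * R.
Hypotheses (p1 : asymptotic p) (q1 : asymptotic q) (pq : p <> q).

Lemma dotp_affine_comb (v : R * R) (s : R) :
  1 - dotp v (affine_comb p q s) = (1 - s) * (1 - dotp v p) + s * (1 - dotp v q).
Proof. by rewrite /dotp /affine_comb /=; ring. Qed.

Lemma sqnorm_chord (s : R) :
  1 - sqnorm (affine_comb p q s) = 2 * (s * (1 - s)) * (1 - dotp p q).
Proof.
transitivity (1 - (1 - s) ^+ 2 * sqnorm p - s ^+ 2 * sqnorm q
              - 2 * (s * (1 - s)) * dotp p q).
  by rewrite /sqnorm /dotp /affine_comb /=; ring.
by rewrite p1 q1; ring.
Qed.

Lemma open_segment_ordinary w : open_segment p q w -> ordinary w.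
Proof.
move=> [s /=]; rewrite in_itv /= => /andP[s0 s1] <-.
rewrite /ordinary -subr_gt0 sqnorm_chord mulr_gt0 ?subr_gt0 ?asymptotic_dotp_lt1//.
by rewrite mulr_gt0// mulr_gt0// subr_gt0.
Qed.

(** For w on the chord with parameter s, the number 1 - <v, w> is the mean
    (1 - s) a + s b of a = 1 - <v, p> and b = 1 - <v, q>, while 1 - |w|^2 is a
    multiple of s (1 - s).  So the distance is least when the two terms of the mean
    are equal, that is for s = a / (a + b), and there
    (cosh d)^2 = 2 a b / ((1 - <p, q>) (1 - |v|^2)). *)
Lemma hdist_set_chord (v : R * R) (k : R) : ordinary v -> 1 <= k ->
  (hdist_set v (open_segment p q) <= arcosh k) =
  (2 * (1 - dotp v p) * (1 - dotp v q) <=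
     k ^+ 2 * (1 - dotp p q) * (1 - sqnorm v)).
Proof.
move=> v1 k1.
have e0 : 0 < 1 - dotp p q by rewrite subr_gt0 asymptotic_dotp_lt1.
have v0 : 0 < 1 - sqnorm v by rewrite subr_gt0.
have a0 : 0 < 1 - dotp v p by rewrite subr_gt0 dotp_lt1 ?p1.
have b0 : 0 < 1 - dotp v q by rewrite subr_gt0 dotp_lt1 ?q1.
set a := 1 - dotp v p in a0 *; set b := 1 - dotp v q in b0 *.
set e := 1 - dotp p q in e0 *; set h := 1 - sqnorm v in v0 *.
have ab0 : 0 < a + b by rewrite addr_gt0.
have ab0' : a + b != 0 by rewrite gt_eqF.
pose s := a / (a + b); pose w0 := affine_comb p q s.
have s01 : 0 < s < 1.
  by rewrite divr_gt0//= ltr_pdivrMr// mul1r ltrDl.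
have sw0 : open_segment p q w0 by exists s; rewrite //= in_itv.
have w1 := open_segment_ordinary sw0.
have formE (c t : R) : disk_form v (c * h) (affine_comb p q t) =
   ((1 - t) * a + t * b) ^+ 2 - c * h * (2 * (t * (1 - t)) * e).
  by rewrite /disk_form dotp_affine_comb sqnorm_chord.
have formE0 (c : R) : disk_form v (c * h) w0 =
   2 * a * b / (a + b) ^+ 2 * (2 * a * b - c * e * h).
  by rewrite /w0 formE /s; field.
have f0 : 0 < 2 * a * b / (a + b) ^+ 2.
  by rewrite divr_gt0 ?exprn_gt0// !mulr_gt0.
have [c c1 [cE _]] := hdistE v1 w1.
have minE w : open_segment p q w -> hdist v w0 <= hdist v w.
  move=> sw; rewrite cE (le_hdist v1 (open_segment_ordinary sw) c1).
  move: sw => [t /=]; rewrite in_itv /= => /andP[t0 t1] <-.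
  rewrite formE.
  have : disk_form v (c ^+ 2 * h) w0 <= 0 by rewrite -hdist_le// cE.
  have : 0 <= disk_form v (c ^+ 2 * h) w0 by rewrite -le_hdist// cE.
  rewrite formE0 pmulr_rge0// pmulr_rle0//.
  rewrite subr_ge0 subr_le0 => H1 H2.
  have E : 2 * a * b = c ^+ 2 * e * h by apply/eqP; rewrite eq_le H1 H2.
  rewrite (_ : _ - _ = ((1 - t) * a + t * b) ^+ 2 - 2 * (t * (1 - t)) * (c ^+ 2 * e * h));
    last by ring.
  rewrite -E (_ : _ - _ = ((1 - t) * a - t * b) ^+ 2) ?sqr_ge0//; ring.
have -> : hdist_set v (open_segment p q) = hdist v w0.
  apply/eqP; rewrite eq_le; apply/andP; split.
    apply: ge_inf; last by exists w0.
    by exists (hdist v w0) => _ [w sw <-]; exact: minE.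
  apply: lb_le_inf; first by exists (hdist v w0), w0.
  by move=> _ [w sw <-]; exact: minE.
by rewrite hdist_le// formE0 pmulr_rle0// subr_le0.
Qed.

(** On the unit circle the right-hand side vanishes, so a point of S there is on the
    tangent at p or at q. *)
Lemma ac_hband_form (S : set (R * R)) (k : R) : 1 < k ->
  S = [set v | 2 * (1 - dotp v p) * (1 - dotp v q) <=
               k * (1 - dotp p q) * (1 - sqnorm v)] ->
  S `<=` [set v | sqnorm v <= 1] ->
  ac_hband p q S.
Proof.
move=> k1 SE sub; split=> //.
have k0 : 0 <= k by rewrite (le_trans ler01)// ltW.
have h1 : 1 < Num.sqrt k.
  by rewrite -[X in X < _]sqrtr1 ltr_sqrt// (lt_trans ltr01).
exists (arcosh (Num.sqrt k)); first exact: arcosh_gt0.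
have key v : ordinary v ->
    (hdist_set v (open_segment p q) <= arcosh (Num.sqrt k)) = `[< S v >].
  move=> v1; rewrite (hdist_set_chord v1 (ltW h1)) sqr_sqrtr// SE.
  by apply/idP/asboolP.
apply/seteqP; split=> [v Sv | v [[v1]|[->|->]]].
- have [v1|] := ltP (sqnorm v) 1.
    by left; split=> //; rewrite key//; apply/asboolP.
  have := sub _ Sv => /= v1 v1'; right.
  have {v1'}v1 : asymptotic v by apply/eqP; rewrite eq_le v1 v1'.
  apply: contrapT => /not_orP[vp vq].
  move: Sv; rewrite SE /= v1 subrr mulr0 leNgt => /negP; apply.
  by rewrite !mulr_gt0// subr_gt0 asymptotic_dotp_lt1.
- by rewrite key// => /asboolP.
- by rewrite SE /= -/(sqnorm p) p1 subrr !mulr0 mul0r.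
- by rewrite SE /= -/(sqnorm q) q1 subrr !mulr0.
Qed.

End Chord.
End DistanceBand.

(** * Shape of the range in BCK *)

Section RangeInBCK.
Import numFieldNormedType.Exports.
Variable R : realType.

Lemma convex_comb_gt0 (w1 w2 s : R) : 0 < w1 -> 0 < w2 -> 0 <= s <= 1 ->
  0 < (1 - s) * w1 + s * w2.
Proof. by move=> w10 w20 /andP[s0 s1]; nra. Qed.

(** The passage to BCK is a projective map, so it preserves segments; the weights
    of the ends get multiplied by their denominators. *)
Lemma bck_closed_segment (p q : R * R) : 0 < p.2 + 1 -> 0 < q.2 + 1 ->
  [set bck_of_pck (Some r) | r in closed_segment p q] =
  closed_segment (bck_of_pck (Some p)) (bck_of_pck (Some q)).
Proof.
case: p q => [x z] [x' z'] /= p0 q0.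
have p0' : z + 1 != 0 by rewrite gt_eqF.
have q0' : z' + 1 != 0 by rewrite gt_eqF.
apply/seteqP; split=> [_ [_ [s s01 <-] <-] | _ [s s01 <-]]; move: s01;
    rewrite /= in_itv /= => /[dup] s01 /andP[s0 s1].
  have W0 := convex_comb_gt0 p0 q0 s01; set W := _ + _ in W0.
  exists (s * (z' + 1) / W).
    rewrite /= in_itv /= ler_pdivrMr// mul1r divr_ge0 ?(ltW W0) ?mulr_ge0 ?(ltW q0)//=.
    by rewrite lerDr mulr_ge0 ?(ltW p0)// subr_ge0.
  have E : (1 - s) * z + s * z' + 1 = W by rewrite /W; ring.
  rewrite /affine_comb /= E.
  have W0' : W != 0 by rewrite gt_eqF.
  by congr (_, _); move: W0'; rewrite /W => W0'; field; rewrite ?W0' ?p0' ?q0'.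
have W0 := convex_comb_gt0 q0 p0 s01; set W := _ + _ in W0.
have W0' : W != 0 by rewrite gt_eqF.
exists (affine_comb (x, z) (x', z') (s * (z + 1) / W)).
  exists (s * (z + 1) / W) => //.
  rewrite /= in_itv /= ler_pdivrMr// mul1r divr_ge0 ?(ltW W0) ?mulr_ge0 ?(ltW p0)//=.
  by rewrite lerDr mulr_ge0 ?(ltW q0)// subr_ge0.
rewrite /affine_comb /=.
have E : (1 - s * (z + 1) / W) * z + s * (z + 1) / W * z' + 1 = (z + 1) * (z' + 1) / W.
  by move: W0'; rewrite /W => W0'; field.
rewrite E.
by congr (_, _); move: W0'; rewrite /W => W0'; field; rewrite W0' p0' q0'.
Qed.

Definition bck_eigenvalue (a b : R) : R * R :=
  bck_of_pck (Some (a, a ^+ 2 + b ^+ 2)).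

Lemma eigen_denominator (a b : R) : 0 < a ^+ 2 + b ^+ 2 + 1.
Proof. by rewrite ltr_wpDl// addr_ge0 ?sqr_ge0. Qed.

Lemma bck_eigenvalue_sqnorm (a b : R) :
  1 - sqnorm (bck_eigenvalue a b) = 4 * b ^+ 2 / (a ^+ 2 + b ^+ 2 + 1) ^+ 2.
Proof.
rewrite bck_of_pck_sqnorm; first by congr (4 * _ / _); ring.
by rewrite gt_eqF ?eigen_denominator.
Qed.

Lemma ordinary_bck_eigenvalue (a b : R) : b != 0 -> ordinary (bck_eigenvalue a b).
Proof.
move=> b0; rewrite /ordinary -subr_gt0 bck_eigenvalue_sqnorm.
apply: divr_gt0; last by rewrite exprn_gt0 ?eigen_denominator.
by apply: mulr_gt0 => //; rewrite exprn_even_gt0.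
Qed.

Lemma asymptotic_bck_eigenvalue (a b : R) : b = 0 -> asymptotic (bck_eigenvalue a b).
Proof.
move=> b0; apply/esym/eqP; rewrite /asymptotic -subr_eq0 bck_eigenvalue_sqnorm b0.
by rewrite expr0n mulr0 mul0r.
Qed.

Lemma bck_eigenvalue_inj (a1 b1 a2 b2 : R) :
  bck_eigenvalue a1 b1 = bck_eigenvalue a2 b2 -> a1 = a2 /\ b1 ^+ 2 = b2 ^+ 2.
Proof.
have D1 := eigen_denominator a1 b1; have D2 := eigen_denominator a2 b2.
rewrite /bck_eigenvalue /= => -[X Z].
set n1 := a1 ^+ 2 + b1 ^+ 2 in D1 X Z; set n2 := a2 ^+ 2 + b2 ^+ 2 in D2 X Z.
have D1' : n1 + 1 != 0 by rewrite gt_eqF.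
have D2' : n2 + 1 != 0 by rewrite gt_eqF.
have n12 : n1 = n2.
  by move/eqP: Z; rewrite eqr_div// => /eqP Z; lra.
have a12 : a1 = a2.
  move: X; rewrite n12 => /(congr1 (fun x => x * (n2 + 1))).
  by rewrite !divfK//; lra.
by split=> //; move: n12; rewrite /n1 /n2 a12; lra.
Qed.

Lemma polar_form_dotp (a b : R) (v : R * R) :
  polar_form a b (1 - v.2) v.1 (1 + v.2) =
  (a ^+ 2 + b ^+ 2 + 1) * (1 - dotp (bck_eigenvalue a b) v).
Proof.
have D0 : a ^+ 2 + b ^+ 2 + 1 != 0 by rewrite gt_eqF ?eigen_denominator.
by rewrite /polar_form /dotp /=; field.
Qed.

Lemma absolute_form_sqnorm (v : R * R) :
  (1 + v.2) * (1 - v.2) - v.1 ^+ 2 = 1 - sqnorm v.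
Proof. by rewrite /sqnorm /dotp; ring. Qed.

Definition bck_range_form (a1 b1 a2 b2 t : R) (v : R * R) : R :=
  range_form a1 b1 a2 b2 t (1 - v.2) v.1 (1 + v.2).

(** The line through the two points vanishes at both of them, and only the term of
    degree 4 in t survives in the rest. *)
Lemma bck_range_form_eigenvalues (a1 b1 a2 b2 t : R) :
  bck_range_form a1 b1 a2 b2 t (bck_eigenvalue a1 b1) =
    - (2 * t ^+ 2 * b1 / (a1 ^+ 2 + b1 ^+ 2 + 1)) ^+ 2 /\
  bck_range_form a1 b1 a2 b2 t (bck_eigenvalue a2 b2) =
    - (2 * t ^+ 2 * b2 / (a2 ^+ 2 + b2 ^+ 2 + 1)) ^+ 2.
Proof.
have D1 : a1 ^+ 2 + b1 ^+ 2 + 1 != 0 by rewrite gt_eqF ?eigen_denominator.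
have D2 : a2 ^+ 2 + b2 ^+ 2 + 1 != 0 by rewrite gt_eqF ?eigen_denominator.
by split; rewrite /bck_range_form /range_form /line_form /polar_form /=; field.
Qed.

Lemma bck_range_form_eigenvalue_lt0 (a1 b1 a2 b2 t : R) : t != 0 ->
  (b1 != 0 -> bck_range_form a1 b1 a2 b2 t (bck_eigenvalue a1 b1) < 0) /\
  (b2 != 0 -> bck_range_form a1 b1 a2 b2 t (bck_eigenvalue a2 b2) < 0).
Proof.
move=> t0; have [-> ->] := bck_range_form_eigenvalues a1 b1 a2 b2 t.
by split=> b0; rewrite oppr_lt0 exprn_even_gt0//= !mulf_neq0 ?expf_neq0 ?pnatr_eq0
  ?invr_eq0// gt_eqF ?eigen_denominator.
Qed.

(** On the circle the absolute form vanishes, and what remains is a square plus a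
    multiple of the product of the polars, of which the first is positive and the
    second is nonnegative, with equality only at the point of contact. *)
Lemma bck_range_form_asymptotic (a1 b1 a2 b2 t : R) (v : R * R) :
  t != 0 -> b1 != 0 -> asymptotic v -> bck_range_form a1 b1 a2 b2 t v <= 0 ->
  b2 = 0 /\ v = bck_eigenvalue a2 b2.
Proof.
move=> t0 b10 v1; rewrite /bck_range_form /range_form absolute_form_sqnorm v1.
rewrite subrr mulr0 subr0 !polar_form_dotp => F0.
set p1 := bck_eigenvalue a1 b1 in F0; set p2 := bck_eigenvalue a2 b2 in F0 *.
have L1 : 0 < 1 - dotp p1 v.
  by rewrite subr_gt0 dotp_lt1 ?v1//; exact: ordinary_bck_eigenvalue.
have D1 := eigen_denominator a1 b1; have D2 := eigen_denominator a2 b2.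
have t2 : 0 < t ^+ 2 by rewrite exprn_even_gt0.
have L2 : 1 - dotp p2 v <= 0.
  rewrite leNgt; apply/negP => L2; move: F0; rewrite leNgt => /negP; apply.
  rewrite ltr_wpDl ?sqr_ge0//; apply: mulr_gt0 => //.
  by apply: mulr_gt0; apply: mulr_gt0.
have [b20|b20] := eqVneq b2 0; last first.
  move: L2; rewrite leNgt subr_gt0 dotp_lt1 ?v1//; exact: ordinary_bck_eigenvalue.
split=> //; apply: contrapT => vp; move: L2; rewrite leNgt subr_gt0.
rewrite asymptotic_dotp_lt1//; last by move=> /esym.
exact: asymptotic_bck_eigenvalue.
Qed.

Section NonNormal.
Variables (a1 b1 a2 b2 t : R).
Hypothesis t0 : t != 0.
Let S := [set v | bck_range_form a1 b1 a2 b2 t v <= 0].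

Lemma bck_range_sub_disk : S `<=` [set v | sqnorm v <= 1].
Proof.
rewrite /S /bck_range_form -(bck_sphere_image a1 b1 a2 b2 t0) => _ [[x z] Kxz <-].
by apply: sqnorm_bck_of_pck_le1; exact: (sphere_image_above_parabola Kxz).
Qed.

Lemma bck_range_interior (v : R * R) :
  bck_range_form a1 b1 a2 b2 t v < 0 -> interior S v.
Proof.
move=> F0; have [a [b [c [d [e [f [_ qE]]]]]]] := range_form_quadric a1 b1 a2 b2 t0.
rewrite (_ : S = [set v | quadric a b c d e f v <= 0]).
  by apply: quadric_interior; rewrite -qE.
by apply/seteqP; split=> w; rewrite /S /= /bck_range_form qE.
Qed.

Lemma bck_range_elliptical : b1 != 0 -> is_elliptical_disk S.
Proof.
move=> b10; have [a [b [c [d [e [f [pd qE]]]]]]] := range_form_quadric a1 b1 a2 b2 t0.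
rewrite (_ : S = [set v | quadric a b c d e f v <= 0]).
  apply: (elliptical_disk_quadric (v0 := bck_eigenvalue a1 b1)) => //.
  by rewrite -qE; have [/(_ b10)] := bck_range_form_eigenvalue_lt0 a1 b1 a2 b2 t0.
by apply/seteqP; split=> w; rewrite /S /= /bck_range_form qE.
Qed.

(** A disk or horodisk equal to the range would have a proportional equation.  The
    eigenvalues are then equal or conjugate, since the first one is not real. *)
Lemma bck_range_eq_disk_form (p : R * R) (k : R) : b1 != 0 -> 0 < k ->
  S = [set v | disk_form p k v <= 0] -> b1 ^+ 2 = b2 ^+ 2 /\ a1 = a2.
Proof.
move=> b10 k0 SE.
have [a [b [c [d [e [f [pd qE]]]]]]] := range_form_quadric a1 b1 a2 b2 t0.
have [a' [b' [c' [d' [e' [f' [pd' qE']]]]]]] := disk_form_quadric p k0.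
have [F0 _] := bck_range_form_eigenvalue_lt0 a1 b1 a2 b2 t0.
have [||m [m' [m0 m'0 mE]]] := same_sublevel_proportional pd pd' (d := d) (e := e)
  (f := f) (d' := d') (e' := e') (f' := f') (v0 := bck_eigenvalue a1 b1).
- by rewrite -qE; exact: F0.
- transitivity S; first by apply/seteqP; split=> w; rewrite /S /= /bck_range_form qE.
  by rewrite SE; apply/seteqP; split=> w; rewrite /= qE'.
have [|b12 [a12|/eqP]] := range_form_square_pencil (m := m / m') (k := k) (p := p)
   (a1 := a1) (b1 := b1) (a2 := a2) (b2 := b2) t0.
- move=> v; rewrite qE -/(disk_form p k v) qE'.
  apply: (mulfI (negbT (gt_eqF m'0))); rewrite -mE.
  by field; rewrite gt_eqF.
- by split.
- by rewrite sqrf_eq0 (negPf b10).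
Qed.

End NonNormal.
End RangeInBCK.

Section RangeShapes.
Variable R : realType.

(** Here [line_form] is zero and the two polars coincide. *)
Lemma bck_range_form_double (a b1 b2 t : R) (v : R * R) : b1 ^+ 2 = b2 ^+ 2 ->
  bck_range_form a b1 a b2 t v =
  (t * (a ^+ 2 + b1 ^+ 2 + 1)) ^+ 2 *
  disk_form (bck_eigenvalue a b1)
    ((4 * b1 ^+ 2 + t ^+ 2) / (a ^+ 2 + b1 ^+ 2 + 1) ^+ 2) v.
Proof.
move=> b12; have D0 : a ^+ 2 + b1 ^+ 2 + 1 != 0.
  by rewrite gt_eqF ?eigen_denominator.
rewrite /bck_range_form /range_form absolute_form_sqnorm.
have -> : polar_form a b2 (1 - v.2) v.1 (1 + v.2) =
          polar_form a b1 (1 - v.2) v.1 (1 + v.2) by rewrite /polar_form b12.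
have -> : line_form a b1 a b2 (1 - v.2) v.1 (1 + v.2) = 0.
  by rewrite /line_form b12; ring.
rewrite polar_form_dotp /disk_form -b12.
by move: (dotp _ _) (sqnorm _) => x y; field.
Qed.

(** For real eigenvalues the polars are tangents of the absolute conic, and the
    square of their chord of contact is in the pencil of their product and the
    absolute form. *)
Lemma bck_range_form_real (a1 a2 t : R) (v : R * R) : a1 != a2 ->
  let p := bck_eigenvalue a1 0 in let q := bck_eigenvalue a2 0 in
  bck_range_form a1 0 a2 0 t v =
  ((a1 - a2) ^+ 2 + t ^+ 2) * (a1 ^+ 2 + 1) * (a2 ^+ 2 + 1) / 2 *
  (2 * (1 - dotp v p) * (1 - dotp v q)
   - (1 + t ^+ 2 / (a1 - a2) ^+ 2) * (1 - dotp p q) * (1 - sqnorm v)).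
Proof.
move=> a12 p q; have D0 : a1 - a2 != 0 by rewrite subr_eq0.
have D1 : a1 ^+ 2 + 1 != 0 by rewrite gt_eqF// ltr_wpDl ?sqr_ge0.
have D2 : a2 ^+ 2 + 1 != 0 by rewrite gt_eqF// ltr_wpDl ?sqr_ge0.
have pqE : 1 - dotp p q = 2 * (a1 - a2) ^+ 2 / ((a1 ^+ 2 + 1) * (a2 ^+ 2 + 1)).
  by rewrite /p /q /dotp /bck_eigenvalue /= expr0n !addr0; field; rewrite D1 D2.
rewrite pqE /bck_range_form /range_form /line_form /polar_form /p /q /dotp.
rewrite /bck_eigenvalue /sqnorm /dotp /=.
by field; rewrite D0 D1 D2.
Qed.

Lemma bck_hdisk (a b1 b2 t : R) : t != 0 -> b1 != 0 -> b1 ^+ 2 = b2 ^+ 2 ->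
  hdisk [set v | bck_range_form a b1 a b2 t v <= 0].
Proof.
move=> t0 b10 b12; apply/hdiskP.
have D2 : 0 < (a ^+ 2 + b1 ^+ 2 + 1) ^+ 2 by rewrite exprn_gt0 ?eigen_denominator.
exists (bck_eigenvalue a b1), ((4 * b1 ^+ 2 + t ^+ 2) / (a ^+ 2 + b1 ^+ 2 + 1) ^+ 2).
split.
- exact: ordinary_bck_eigenvalue.
- by rewrite bck_eigenvalue_sqnorm ltr_pM2r ?invr_gt0// ltrDl exprn_even_gt0.
apply/seteqP; split=> v /=; rewrite bck_range_form_double// pmulr_rle0//;
  by rewrite exprn_even_gt0//= mulf_neq0// gt_eqF ?eigen_denominator.
Qed.

Lemma bck_ac_horodisk (a t : R) : t != 0 ->
  ac_horodisk (bck_eigenvalue a 0) [set v | bck_range_form a 0 a 0 t v <= 0].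
Proof.
move=> t0; apply/ac_horodiskP; split; first exact: asymptotic_bck_eigenvalue.
exists ((4 * 0 ^+ 2 + t ^+ 2) / (a ^+ 2 + 0 ^+ 2 + 1) ^+ 2).
  apply: divr_gt0; last by apply: exprn_gt0; exact: eigen_denominator.
  by rewrite expr0n mulr0 add0r exprn_even_gt0.
apply/seteqP; split=> v /=; rewrite bck_range_form_double// pmulr_rle0//;
  by rewrite exprn_even_gt0//= mulf_neq0// gt_eqF ?eigen_denominator.
Qed.

Lemma bck_ac_hband (a1 a2 t : R) : t != 0 -> a1 != a2 ->
  ac_hband (bck_eigenvalue a1 0) (bck_eigenvalue a2 0)
    [set v | bck_range_form a1 0 a2 0 t v <= 0].
Proof.
move=> t0 a12.
have d0 : 0 < (a1 - a2) ^+ 2 by rewrite exprn_even_gt0//= subr_eq0.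
have t2 : 0 < t ^+ 2 by rewrite exprn_even_gt0.
have d1 : 0 < a1 ^+ 2 + 1 by rewrite ltr_wpDl ?sqr_ge0.
have d2 : 0 < a2 ^+ 2 + 1 by rewrite ltr_wpDl ?sqr_ge0.
apply: (@ac_hband_form _ _ _ _ _ _ _ (1 + t ^+ 2 / (a1 - a2) ^+ 2)).
- exact: asymptotic_bck_eigenvalue.
- exact: asymptotic_bck_eigenvalue.
- by move=> /bck_eigenvalue_inj[/eqP]; rewrite (negPf a12).
- by rewrite ltrDl divr_gt0.
- apply/seteqP; split=> v /=; rewrite bck_range_form_real// pmulr_rle0 ?subr_le0//;
    by apply: divr_gt0 => //; do 2?apply: mulr_gt0 => //; exact: addr_gt0.
- exact: bck_range_sub_disk.
Qed.

Lemma bck_proper_helliptical_disk (a1 b1 a2 b2 t : R) : t != 0 ->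
  b1 != 0 -> b2 != 0 -> ~ (b1 ^+ 2 = b2 ^+ 2 /\ a1 = a2) ->
  proper_helliptical_disk [set v | bck_range_form a1 b1 a2 b2 t v <= 0].
Proof.
move=> t0 b10 b20 ne; split.
- exact: bck_range_elliptical.
- move=> v Sv; rewrite /ordinary lt_neqAle (bck_range_sub_disk t0 Sv) andbT.
  apply/eqP => v1; have [/eqP] := bck_range_form_asymptotic t0 b10 v1 Sv.
  by rewrite (negPf b20).
- move=> /hdiskP[p [k [p1 pk SE]]]; apply: ne.
  apply: (bck_range_eq_disk_form t0 b10 _ SE).
  by apply: lt_trans pk; rewrite subr_gt0.
Qed.

Lemma bck_helliptic_parabolic_disk (a1 b1 a2 t : R) : t != 0 -> b1 != 0 ->
  helliptic_parabolic_disk (bck_eigenvalue a2 0)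
    [set v | bck_range_form a1 b1 a2 0 t v <= 0].
Proof.
move=> t0 b10; split.
- exact: bck_range_elliptical.
- exact: bck_range_sub_disk.
- apply/seteqP; split=> [v [Sv v1]|_ ->] /=.
    by have [] := bck_range_form_asymptotic t0 b10 v1 Sv.
  split; last exact: asymptotic_bck_eigenvalue.
  have [_ ->] := bck_range_form_eigenvalues a1 b1 a2 0 t.
  by rewrite oppr_le0 sqr_ge0.
- move=> [q /ac_horodiskP[q1 [k k0 SE]]].
  have [/eqP] := bck_range_eq_disk_form t0 b10 k0 SE.
  by rewrite expr0n sqrf_eq0 (negPf b10).
Qed.

End RangeShapes.

Section ComplexParameters.
Variable R : realType.
Implicit Types l : R[i].

Lemma iota2_BCKE l : iota2 BCK l = bck_eigenvalue (complex.Re l) (complex.Im l).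
Proof. by rewrite /= sqmodcE. Qed.

Lemma complex_realE l : (l \is Num.real) = (complex.Im l == 0).
Proof. by case: l => a b; rewrite complex_real. Qed.

Lemma eq_Re_Im l1 l2 : complex.Re l1 = complex.Re l2 ->
  complex.Im l1 ^+ 2 = complex.Im l2 ^+ 2 -> l1 = l2 \/ l1 = Num.conj l2.
Proof.
case: l1 l2 => a1 b1 [a2 b2] /= -> /eqP; rewrite eqf_sqr.
by move=> /orP[]/eqP->; [left | right].
Qed.

End ComplexParameters.

Section ConformalRange.
Variables (R : realType) (V : vectType R[i]) (dot : {dot V for Num.conj}).
Hypothesis dimV : \dim {:V} = 2%N.
Variables (A : 'End(V)) (l1 l2 : R[i]).
Hypothesis eig : eigenvalues A l1 l2.

Local Notation a1 := (complex.Re l1).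
Local Notation b1 := (complex.Im l1).
Local Notation a2 := (complex.Re l2).
Local Notation b2 := (complex.Im l2).

Lemma conformal_range : exists t : R, (is_normal dot A <-> t = 0) /\
  DW_pCK dot A = [set Some p | p in sphere_image a1 b1 a2 b2 t].
Proof.
have [e1 [e2 [t [[e11 e22 e12] Ae1 Ae2 nt]]]] := schur_decomposition dot dimV eig.
by exists t; split => //; exact: (DW_pCK_sphere_image dimV e11 e22 e12 Ae1 Ae2).
Qed.

Lemma conformal_range_carrier : DW_pCK dot A `<=` carrier R pCK.
Proof.
have [t [_ ->]] := conformal_range.
by move=> _ [[x z] /sphere_image_above_parabola xz <-].
Qed.

Lemma conformal_range_normal_pCK : is_normal dot A ->
  DW_pCK dot A = [set Some p | p in closed_segment (a1, a1 ^+ 2 + b1 ^+ 2)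
                                                   (a2, a2 ^+ 2 + b2 ^+ 2)].
Proof.
have [t [nt ->]] := conformal_range.
by move=> /nt->; rewrite sphere_image_normal.
Qed.

Lemma conformal_range_normal_BCK : is_normal dot A ->
  DW_BCK dot A = closed_segment (iota2 BCK l1) (iota2 BCK l2).
Proof.
move=> nA; rewrite DW_BCK_pCK conformal_range_normal_pCK// image_comp.
rewrite !iota2_BCKE -bck_closed_segment ?eigen_denominator//.
Qed.

Lemma conformal_range_nonnormal_BCK : ~ is_normal dot A ->
  exists2 t : R, t != 0 &
    DW_BCK dot A = [set v | bck_range_form a1 b1 a2 b2 t v <= 0].
Proof.
have [t [nt DE]] := conformal_range => nA.
have t0 : t != 0 by apply/eqP => t0; apply/nA/nt.
by exists t => //; rewrite DW_BCK_pCK DE image_comp -bck_sphere_image.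
Qed.

Lemma conformal_range_point M : is_normal dot A -> a1 = a2 -> b1 ^+ 2 = b2 ^+ 2 ->
  DW dot M A = [set iota2 M l1].
Proof.
move=> nA a12 b12; apply: DW_singleton.
rewrite conformal_range_normal_pCK// -a12 -b12 /= sqmodcE.
set p := (_, _); rewrite (_ : closed_segment p p = [set p]) ?image_set1//.
apply/seteqP; split=> [_ [s _ <-]|_ ->] /=.
  by rewrite /affine_comb [RHS]surjective_pairing; congr (_, _); ring.
exists 0; first by rewrite /= in_itv /= lexx ler01.
by rewrite /affine_comb [RHS]surjective_pairing; congr (_, _); ring.
Qed.

End ConformalRange.

(** * The classification *)

Theorem theorem2p5 (R : realType) (V : vectType R[i])
    (dot : {dot V for Num.conj}) (A : 'End(V)) (M : model)
    (dimV : \dim {:V} = 2%N) :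
  (* (i) *)
  (is_normal dot A -> forall l : R[i], l \isn't Num.real ->
     eigenvalues A l l \/ eigenvalues A l (Num.conj l) ->
     is_ordinary (iota2 M l) /\ DW dot M A = [set iota2 M l]) /\
  (* (ii) *)
  (is_normal dot A -> forall l1 l2 : R[i],
     l1 \isn't Num.real -> l2 \isn't Num.real ->
     l1 <> l2 -> l1 <> Num.conj l2 -> eigenvalues A l1 l2 ->
     is_hsegment (iota2 M l1) (iota2 M l2) (DW dot M A)) /\
  (* (iii) *)
  (is_normal dot A -> forall l1 l2 : R[i],
     l1 \is Num.real -> l2 \is Num.real ->
     l1 <> l2 -> eigenvalues A l1 l2 ->
     is_ac_hline (iota2 M l1) (iota2 M l2) (DW dot M A)) /\
  (* (iv) *)
  (is_normal dot A -> forall l1 l2 : R[i],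
     l1 \isn't Num.real -> l2 \is Num.real -> eigenvalues A l1 l2 ->
     is_ac_half_hline (iota2 M l1) (iota2 M l2) (DW dot M A)) /\
  (* (v) *)
  (is_normal dot A -> forall l : R[i], l \is Num.real ->
     eigenvalues A l l ->
     is_asymptotic (iota2 M l) /\ DW dot M A = [set iota2 M l]) /\
  (* (vi) *)
  (~ is_normal dot A -> forall l : R[i], l \isn't Num.real ->
     eigenvalues A l l \/ eigenvalues A l (Num.conj l) ->
     is_hdisk (DW dot M A) /\ is_interior (iota2 M l) (DW dot M A)) /\
  (* (vii) *)
  (~ is_normal dot A -> forall l1 l2 : R[i],
     l1 \isn't Num.real -> l2 \isn't Num.real ->
     l1 <> l2 -> l1 <> Num.conj l2 -> eigenvalues A l1 l2 ->
     [/\ is_proper_helliptical_disk (DW dot M A),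
         is_interior (iota2 M l1) (DW dot M A) &
         is_interior (iota2 M l2) (DW dot M A)]) /\
  (* (viii) *)
  (~ is_normal dot A -> forall l1 l2 : R[i],
     l1 \is Num.real -> l2 \is Num.real ->
     l1 <> l2 -> eigenvalues A l1 l2 ->
     is_ac_hband (iota2 M l1) (iota2 M l2) (DW dot M A)) /\
  (* (ix) *)
  (~ is_normal dot A -> forall l1 l2 : R[i],
     l1 \isn't Num.real -> l2 \is Num.real -> eigenvalues A l1 l2 ->
     is_helliptic_parabolic_disk (iota2 M l2) (DW dot M A) /\
     is_interior (iota2 M l1) (DW dot M A)) /\
  (* (x) *)
  (~ is_normal dot A -> forall l : R[i], l \is Num.real ->
     eigenvalues A l l ->
     is_ac_horodisk (iota2 M l) (DW dot M A)).
Proof.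
have realN (l : R[i]) : l \isn't Num.real -> complex.Im l != 0 by rewrite complex_realE.
have realP (l : R[i]) : l \is Num.real -> complex.Im l = 0
  by rewrite complex_realE => /eqP.
have sub l1 l2 : eigenvalues A l1 l2 -> DW_pCK dot A `<=` carrier R pCK.
  exact: conformal_range_carrier.
have double l : eigenvalues A l l \/ eigenvalues A l (Num.conj l) ->
    exists2 l', eigenvalues A l l' &
      complex.Re l = complex.Re l' /\ complex.Im l ^+ 2 = complex.Im l' ^+ 2.
  by case: l => a b [e|e]; eexists; try exact: e; split; rewrite //= sqrrN.
refine (conj _ (conj _ (conj _ (conj _ (conj _
  (conj _ (conj _ (conj _ (conj _ _))))))))).
- move=> nA l /realN l0 /double[l' eig [re im]]; split.
    exists (iota2 BCK l); first exact: canonical_iota2.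
    by rewrite iota2_BCKE; exact: ordinary_bck_eigenvalue.
  exact: (conformal_range_point dimV eig).
- move=> nA l1 l2 /realN l10 /realN l20 l12 l12c eig.
  apply: (DW_transport2 (sub _ _ eig)); rewrite (conformal_range_normal_BCK dimV eig)//.
  split => //; rewrite !iota2_BCKE; try exact: ordinary_bck_eigenvalue.
  by move=> /bck_eigenvalue_inj[re im]; have [] := eq_Re_Im re im.
- move=> nA l1 l2 /realP l10 /realP l20 l12 eig.
  apply: (DW_transport2 (sub _ _ eig)); rewrite (conformal_range_normal_BCK dimV eig)//.
  split => //; rewrite !iota2_BCKE; try exact: asymptotic_bck_eigenvalue.
  move=> /bck_eigenvalue_inj[re _]; apply: l12.
  by case: l1 l2 re l10 l20 {eig} => [? ?] [? ?] /= -> -> ->.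
- move=> nA l1 l2 /realN l10 /realP l20 eig.
  apply: (DW_transport2 (sub _ _ eig)); rewrite (conformal_range_normal_BCK dimV eig)//.
  by split => //; rewrite iota2_BCKE;
    [exact: ordinary_bck_eigenvalue | exact: asymptotic_bck_eigenvalue].
- move=> nA l /realP l0 eig; split.
    exists (iota2 BCK l); first exact: canonical_iota2.
    by rewrite iota2_BCKE; exact: asymptotic_bck_eigenvalue.
  exact: (conformal_range_point dimV eig).
- move=> nA l /realN l0 /double[l' eig [re im]].
  have [t t0 DE] := conformal_range_nonnormal_BCK dimV eig nA; split.
    by apply: (DW_transport0 (sub _ _ eig)); rewrite DE -re; exact: bck_hdisk.
  apply: (DW_transport1 (sub _ _ eig)); rewrite DE iota2_BCKE.
  apply: bck_range_interior => //.
  by have [/(_ l0)] := bck_range_form_eigenvalue_lt0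
    (complex.Re l) (complex.Im l) (complex.Re l') (complex.Im l') t0.
- move=> nA l1 l2 /realN l10 /realN l20 l12 l12c eig.
  have [t t0 DE] := conformal_range_nonnormal_BCK dimV eig nA.
  have [/(_ l10) F1 /(_ l20) F2] := bck_range_form_eigenvalue_lt0
    (complex.Re l1) (complex.Im l1) (complex.Re l2) (complex.Im l2) t0.
  split.
  + apply: (DW_transport0 (sub _ _ eig)); rewrite DE.
    apply: bck_proper_helliptical_disk => //.
    by move=> [im re]; have [] := eq_Re_Im re im.
  + apply: (DW_transport1 (sub _ _ eig)); rewrite DE iota2_BCKE.
    exact: bck_range_interior.
  + apply: (DW_transport1 (sub _ _ eig)); rewrite DE iota2_BCKE.
    exact: bck_range_interior.
- move=> nA l1 l2 /realP l10 /realP l20 l12 eig.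
  have [t t0 DE] := conformal_range_nonnormal_BCK dimV eig nA.
  apply: (DW_transport2 (sub _ _ eig)); rewrite DE !iota2_BCKE l10 l20.
  apply: bck_ac_hband => //; apply/eqP => re; apply: l12.
  by case: l1 l2 re l10 l20 {eig DE} => [? ?] [? ?] /= -> -> ->.
- move=> nA l1 l2 /realN l10 /realP l20 eig.
  have [t t0 DE] := conformal_range_nonnormal_BCK dimV eig nA; split.
    apply: (DW_transport1 (sub _ _ eig)); rewrite DE iota2_BCKE l20.
    exact: bck_helliptic_parabolic_disk.
  apply: (DW_transport1 (sub _ _ eig)); rewrite DE iota2_BCKE.
  apply: bck_range_interior => //.
  by have [/(_ l10)] := bck_range_form_eigenvalue_lt0
    (complex.Re l1) (complex.Im l1) (complex.Re l2) (complex.Im l2) t0.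
- move=> nA l /realP l0 eig.
  have [t t0 DE] := conformal_range_nonnormal_BCK dimV eig nA.
  apply: (DW_transport1 (sub _ _ eig)); rewrite DE iota2_BCKE l0.
  exact: bck_ac_horodisk.
Qed.
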